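(* Let $n\geq 1$ be an integer. (1) Every embedding of $\mathbb{C}\times\mathbb{C}\times\mathbb{C}\times\mathbb{C}$ into $\mathbb{S}^n$ is congruent to $$A^{(1)}_{k_1,k_2,k_3,k_4}:=\operatorname{Diag}(x{\bf 1}_{k_1+k_2+k_3+k_4},y{\bf 1}_{k_2+k_3+k_4},z{\bf 1}_{k_3+k_4},w{\bf 1}_{k_4})$$ for some integers $k_1,k_2,k_3\geq0$ and $k_4\geq1$ with $k_1+2k_2+3k_3+4k_4=n$. (2) Every embedding of $\mathbb{C}\times\mathbb{C}\times\mathcal{J}^1_0$ into $\mathbb{S}^n$ is congruent to $$A^{(2)}_{k_1,k_2,\ell_1,\ell_2}:=\operatorname{Diag}\left(x{\bf 1}_{k_1+k_2},y{\bf 1}_{k_2},{\bf 1}_{\ell_2}\otimes\begin{pmatrix}w&z\\ z&0\end{pmatrix},z{\bf 1}_{\ell_1}\right)$$ for some integers $k_1,\ell_1\geq0$ and $k_2,\ell_2\geq1$ with $k_1+2k_2+\ell_1+2\ell_2=n$. (3) Every embedding of $\mathcal{J}^1_0\times\mathcal{J}^1_0$ into $\mathbb{S}^n$ is congruent to $$A^{(3)}_{k_1,k_2,\ell_1,\ell_2}:=\operatorname{Diag}\left({\bf 1}_{k_2}\otimes\begin{pmatrix}y&x\\ x&0\end{pmatrix},x{\bf 1}_{k_1},{\bf 1}_{\ell_2}\otimes\begin{pmatrix}w&z\\ z&0\end{pmatrix},z{\bf 1}_{\ell_1}\right)$$ for some integers $k_1,\ell_1\geq0$ and $k_2,\ell_2\geq1$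 with $k_1+2k_2+\ell_1+2\ell_2=n$, where $A^{(3)}_{k_1,k_2,\ell_1,\ell_2}$ and $A^{(3)}_{\ell_1,\ell_2,k_1,k_2}$ are congruent. (4) Every embedding of $\mathbb{C}\times\mathbb{C}[x]/(x^3)$ into $\mathbb{S}^n$ is congruent to $$A^{(4)}_{r,k_1,k_2,k_3}:=\operatorname{Diag}\left(w{\bf 1}_r,{\bf 1}_{k_3}\otimes\begin{pmatrix}z&y&x\\ y&x&0\\ x&0&0\end{pmatrix},{\bf 1}_{k_2}\otimes\begin{pmatrix}y&x\\ x&0\end{pmatrix},x{\bf 1}_{k_1}\right)$$ for some integers $k_1,k_2\geq0$ and $r,k_3\geq1$ with $k_1+2k_2+3k_3=n-r$. (5) Every embedding of $\mathbb{C}[x]/(x^4)$ into $\mathbb{S}^n$ is congruent to $$A^{(5)}_{k_1,k_2,k_3,k_4}:=\operatorname{Diag}\left({\bf 1}_{k_4}\otimes\begin{pmatrix}w&z&y&x\\ z&y&x&0\\ y&x&0&0\\ x&0&0&0\end{pmatrix},{\bf 1}_{k_3}\otimes\begin{pmatrix}z&y&x\\ y&x&0\\ x&0&0\end{pmatrix},{\bf 1}_{k_2}\otimes\begin{pmatrix}y&x\\ x&0\end{pmatrix},x{\bf 1}_{k_1}\right)$$ for some integers $k_1,k_2,k_3\geq0$ and $k_4\geq1$ with $k_1+2k_2+3k_3+4k_4=n$. (6) Every embedding of $\mathbb{C}\times\mathcal{J}^2_2$ into $\mathbb{S}^n$ is congruent to $$B^{(1)}_{k_1,k_2}:=\operatorname{Diag}\left(w{\bf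 1}_{k_1},\begin{pmatrix}x&y\\ y&z\end{pmatrix}\otimes{\bf 1}_{k_2}\right)$$ for some integers $k_1,k_2\geq1$ with $k_1+2k_2=n$. (7) Every embedding of $\mathbb{C}\times\mathcal{J}^2_1$ into $\mathbb{S}^n$ is congruent to $$B^{(2)}_{r,k,\ell_1,\ell_2}:=\operatorname{Diag}\left(w{\bf 1}_r,\begin{pmatrix}x{\bf J}_{\ell_2}&z\operatorname{Diag}({\bf 1}_k,{\bf 0}_{\ell_2-k})\\ z\operatorname{Diag}({\bf 1}_k,{\bf 0}_{\ell_2-k})&y{\bf J}_{\ell_2}\end{pmatrix},y{\bf 1}_{\ell_1}\right)$$ for some integers $\ell_1\geq0$, $r\geq 1$, $\ell_2\geq2$ and $1\leq k\leq \ell_2/2$ such that $\ell_1+2\ell_2=n-r$. (8) The Jordan algebra $\mathcal{J}^3_3$ has no embeddings into $\mathbb{S}^n$ when $4\nmid n$. When $4\mid n$, every embedding of $\mathcal{J}_3^3$ into $\mathbb{S}^n$ is congruent to $$C^{(1)}_{n/4}:=\begin{pmatrix}x{\bf 1}_{n/2}&z{\bf 1}_{n/2}+w{\bf 1}_{n/4}\otimes\begin{pmatrix}0&1\\-1&0\end{pmatrix}\\ z{\bf 1}_{n/2}+w{\bf 1}_{n/4}\otimes\begin{pmatrix}0&-1\\1&0\end{pmatrix}&y{\bf 1}_{n/2}\end{pmatrix}.$$ (9) The Jordan algebra $\mathcal{J}^3_2$ has no embeddings into $\mathbb{S}^n$ when $n$ is odd. When $n$ is even, every embedding of $\mathcal{J}_2^3$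 into $\mathbb{S}^n$ is congruent to $$C^{(2)}_{n/2,k}:=\begin{pmatrix}x{\bf J}_{n/2}&z{\bf J}_{n/2}+w\operatorname{Diag}\left({\bf 1}_k\otimes\begin{pmatrix}0&1\\-1&0\end{pmatrix},{\bf 0}_{n/2-2k}\right)\\ z{\bf J}_{n/2}+w\operatorname{Diag}\left({\bf 1}_k\otimes\begin{pmatrix}0&-1\\1&0\end{pmatrix},{\bf 0}_{n/2-2k}\right)&y{\bf J}_{n/2}\end{pmatrix}$$ for some integer $1\leq k\leq n/8$.
   Context: $\mathbb{S}^n$ is the space of complex symmetric $n\times n$ matrices. A (unital) Jordan algebra is a complex vector space with a symmetric bilinear product satisfying $(x\cdot x)\cdot(x\cdot y)=x\cdot((x\cdot x)\cdot y)$ for all $x,y$ and having a unit; morphisms are linear maps preserving products and units. For an invertible $U\in\mathbb{S}^n$, the product $X\bullet_U Y=\frac12(XU^{-1}Y+YU^{-1}X)$ makes $\mathbb{S}^n$ a unital Jordan algebra with unit $U$. An embedding of a Jordan algebra $\mathcal{A}$ into $\mathbb{S}^n$ is the image of an injective morphism of unital Jordan algebras $\mathcal{A}\to(\mathbb{S}^n,\bullet_U)$ for some invertible $U\in\mathbb{S}^n$. Two subspaces $\mathcal{L},\mathcal{L}'\subseteq\mathbb{S}^n$ are congruent if $\mathcal{L}'=P\mathcal{L}P^\top$ for some $P\in\mathrm{GL}_n(\mathbb{C})$. For integers $d\ge1$, $0\le r\le d$, $\mathcal{J}^d_r$ is the Jordan algebra $\mathbb{C}\times\mathbb{C}^d$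 with product $(\lambda,v)\cdot(\mu,w)=(\lambda\mu+\beta(v,w),\lambda w+\mu v)$, where $\beta(v,w)=v_1w_1+\dots+v_rw_r$. Products of Jordan algebras carry the componentwise product; $\mathbb{C}$ and $\mathbb{C}[x]/(x^m)$ carry their usual commutative product. A matrix whose entries are linear forms in indeterminates $x,y,z,w$ denotes the linear space of all matrices obtained by substituting complex numbers for the indeterminates. ${\bf 1}_k$ and ${\bf 0}_k$ are the $k\times k$ identity and zero matrices, ${\bf J}_k$ is the $k\times k$ matrix with $1$'s on the anti-diagonal and $0$'s elsewhere, $\operatorname{Diag}(\dots)$ is the block-diagonal matrix with the given blocks (blocks of size $0$ are omitted), and $X\otimes Y$ is the Kronecker product, the block matrix with blocks $X_{ij}Y$. *)

(* Defs.v *)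
From HB Require Import structures.
From mathcomp Require Import all_boot all_order all_algebra.
From mathcomp Require Import qpoly mxtens complex.
From mathcomp Require Import classical_sets reals.
From mathcomp Require Import ring.

Set Implicit Arguments.
Unset Strict Implicit.
Unset Printing Implicit Defensive.
Import Order.TTheory GRing.Theory Num.Theory.
Local Open Scope ring_scope.

Record jordanAlg (K : numFieldType) := JordanAlg {
  jcar :> lmodType K;
  jmul : jcar -> jcar -> jcar;
  jone : jcar;
  jmulC : forall x y, jmul x y = jmul y x;
  jmulP : forall a x y z, jmul (a *: x + y) z = a *: jmul x z + jmul y z;
  jmul1 : forall x, jmul jone x = x;
  jordan_identity : forall x y,
    jmul (jmul x x) (jmul x y) = jmul x (jmul (jmul x x) y) }.

Arguments jone {K} _.

Definition jordan_morphism (K : numFieldType) (A B : jordanAlg K)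
    (f : {linear A -> B}) : Prop :=
  (forall x y, f (jmul x y) = jmul (f x) (f y)) /\ f (jone A) = jone B.

Section ComAlgJordan.
Variables (K : numFieldType) (A : comAlgType K).

Fact com_jmulP (a : K) (x y z : A) : (a *: x + y) * z = a *: (x * z) + y * z.
Proof. by rewrite mulrDl scalerAl. Qed.

Fact com_jordan (x y : A) : (x * x) * (x * y) = x * ((x * x) * y).
Proof. by rewrite !mulrA. Qed.

Definition comJ : jordanAlg K :=
  @JordanAlg K A *%R 1 (@mulrC A) com_jmulP (@mul1r A) com_jordan.

End ComAlgJordan.

Section ProdJordan.
Variables (K : numFieldType) (A B : jordanAlg K).

Definition prod_jmul (x y : A * B) : A * B := (jmul x.1 y.1, jmul x.2 y.2).

Fact prod_jmulC x y : prod_jmul x y = prod_jmul y x.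
Proof. by rewrite /prod_jmul jmulC [jmul x.2 _]jmulC. Qed.

Fact prod_jmulP (a : K) x y z :
  prod_jmul (a *: x + y) z = a *: prod_jmul x z + prod_jmul y z.
Proof. by rewrite /prod_jmul /= !jmulP. Qed.

Fact prod_jmul1 x : prod_jmul (jone A, jone B) x = x.
Proof. by case: x => x1 x2; rewrite /prod_jmul /= !jmul1. Qed.

Fact prod_jordan x y : prod_jmul (prod_jmul x x) (prod_jmul x y) =
  prod_jmul x (prod_jmul (prod_jmul x x) y).
Proof. by rewrite /prod_jmul /= !jordan_identity. Qed.

Definition prodJ : jordanAlg K :=
  @JordanAlg K (A * B)%type prod_jmul (jone A, jone B)
    prod_jmulC prod_jmulP prod_jmul1 prod_jordan.

End ProdJordan.

Section SpinJordan.
Variables (K : numFieldType) (d r : nat).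

Definition spin_form (v w : 'rV[K]_d) : K :=
  \sum_(i < d | (i < r)%N) v 0 i * w 0 i.

Definition spin_jmul (x y : K^o * 'rV[K]_d) : K^o * 'rV[K]_d :=
  (x.1 * y.1 + spin_form x.2 y.2, x.1 *: y.2 + y.1 *: x.2).

Fact spin_formC v w : spin_form v w = spin_form w v.
Proof. by apply: eq_bigr => i _; rewrite mulrC. Qed.

Fact spin_formP a u v w :
  spin_form (a *: u + v) w = a * spin_form u w + spin_form v w.
Proof.
rewrite /spin_form mulr_sumr -big_split; apply: eq_bigr => i _ /=.
by rewrite !mxE mulrDl mulrA.
Qed.

Fact spin_jmulC x y : spin_jmul x y = spin_jmul y x.
Proof. by rewrite /spin_jmul spin_formC mulrC [X in (_, X)]addrC. Qed.

Fact spin_jmulP (a : K) x y z :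
  spin_jmul (a *: x + y) z = a *: spin_jmul x z + spin_jmul y z.
Proof.
case: x y z => [x1 x2] [y1 y2] [z1 z2]; rewrite /spin_jmul /=.
congr (_, _) => /=.
  by rewrite spin_formP /GRing.scale /=; ring.
by apply/rowP => i; rewrite !mxE /GRing.scale /=; ring.
Qed.

Fact spin_jmul1 x : spin_jmul (1, 0) x = x.
Proof.
case: x => x1 x2; rewrite /spin_jmul /= scale1r scaler0 addr0 mul1r.
by rewrite /spin_form big1 ?addr0 // => i _; rewrite mxE mul0r.
Qed.

Fact spin_jordan x y : spin_jmul (spin_jmul x x) (spin_jmul x y) =
  spin_jmul x (spin_jmul (spin_jmul x x) y).
Proof.
case: x y => [x1 x2] [y1 y2]; rewrite /spin_jmul /=.
have formDr u v w : spin_form u (v + w) = spin_form u v + spin_form u w.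
  by rewrite spin_formC -[v]scale1r spin_formP scale1r mul1r !(spin_formC u).
have formDl u v w : spin_form (u + v) w = spin_form u w + spin_form v w.
  by rewrite spin_formC formDr !(spin_formC w).
have formZr b u v : spin_form u (b *: v) = b * spin_form u v.
  rewrite /spin_form mulr_sumr; apply: eq_bigr => i _.
  by rewrite mxE mulrCA.
have formZl b u v : spin_form (b *: u) v = b * spin_form u v.
  by rewrite spin_formC formZr spin_formC.
rewrite !(formDr, formDl, formZr, formZl).
congr (_, _) => /=; first by ring.
by apply/rowP => i; rewrite !mxE; ring.
Qed.

Definition spinJ : jordanAlg K :=
  @JordanAlg K (K^o * 'rV[K]_d)%type spin_jmul (1, 0)
    spin_jmulC spin_jmulP spin_jmul1 spin_jordan.

End SpinJordan.

Section SymMatrices.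
Variables (K : numFieldType) (n : nat).

Definition sym_pred : {pred 'M[K]_n} := fun X => X^T == X.

Fact sym_submod_closed : submod_closed sym_pred.
Proof.
split; first by rewrite unfold_in trmx0.
move=> a X Y; rewrite !unfold_in => /eqP hX /eqP hY.
by rewrite linearP /= hX hY.
Qed.

HB.instance Definition _ :=
  GRing.isSubmodClosed.Build K 'M[K]_n sym_pred sym_submod_closed.

Record symmx := Symmx { symval :> 'M[K]_n; symvalP : symval \in sym_pred }.

HB.instance Definition _ := [isSub for symval].
HB.instance Definition _ := [Choice of symmx by <:].
HB.instance Definition _ := [SubChoice_isSubLmodule of symmx by <:].

End SymMatrices.

Section SymJordan.
Variables (K : numFieldType) (n : nat) (U : symmx K n).
Hypothesis U_unit : symval U \in unitmx.

Local Notation V := (invmx U).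

Definition sym_prod (X Y : 'M[K]_n) : 'M[K]_n :=
  2^-1 *: (X *m V *m Y + Y *m V *m X).

Fact sym_prod_sym (X Y : symmx K n) : sym_prod X Y \in @sym_pred K n.
Proof.
have /eqP hX := symvalP X; have /eqP hY := symvalP Y; have /eqP hU := symvalP U.
rewrite unfold_in /sym_prod linearZ linearD /= !trmx_mul trmx_inv hX hY hU.
by rewrite !mulmxA addrC.
Qed.

Definition sym_jmul (X Y : symmx K n) : symmx K n := Symmx (sym_prod_sym X Y).

Fact sym_jmulC X Y : sym_jmul X Y = sym_jmul Y X.
Proof. by apply: val_inj; rewrite /= /sym_prod addrC. Qed.

Fact sym_jmulP (a : K) X Y Z :
  sym_jmul (a *: X + Y) Z = a *: sym_jmul X Z + sym_jmul Y Z.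
Proof.
apply: val_inj; rewrite /= /sym_prod !mulmxDl !mulmxDr.
rewrite -!scalemxAl -!scalemxAr scalerA mulrC -scalerA -scalerDr.
by congr (_ *: _); rewrite scalerDr addrACA.
Qed.

Fact sym_jmul1 X : sym_jmul U X = X.
Proof.
apply: val_inj; rewrite /= /sym_prod mulmxV // mul1mx -mulmxA mulVmx // mulmx1.
by rewrite -mulr2n -scaler_nat scalerA mulVf ?scale1r // pnatr_eq0.
Qed.

Fact sym_jordan X Y : sym_jmul (sym_jmul X X) (sym_jmul X Y) =
  sym_jmul X (sym_jmul (sym_jmul X X) Y).
Proof.
apply: val_inj; rewrite /= /sym_prod.
have -> : 2^-1 *: (X *m V *m X + X *m V *m X) = X *m V *m X.
  by rewrite -mulr2n -scaler_nat scalerA mulVf ?scale1r // pnatr_eq0.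
rewrite -!(scalemxAl, scalemxAr) -!scalerDr !(mulmxDl, mulmxDr) !mulmxA.
congr (_ *: (_ *: _)).
by rewrite !addrA; congr (_ + _); rewrite addrAC.
Qed.

Definition symJ : jordanAlg K :=
  @JordanAlg K (symmx K n) sym_jmul U sym_jmulC sym_jmulP sym_jmul1 sym_jordan.

End SymJordan.

Definition is_embedding (K : numFieldType) (A : jordanAlg K) (n : nat)
    (L : set 'M[K]_n) : Prop :=
  exists (U : symmx K n) (U_unit : symval U \in unitmx)
         (f : {linear A -> symJ U_unit}),
    [/\ jordan_morphism f, injective f
      & L = [set symval (f a) | a in [set: A]]%classic].

(* The sizes of the normal forms below are only propositionally equal to n. *)
Definition congruent (K : numFieldType) (m n : nat)
    (L : set 'M[K]_m) (L' : set 'M[K]_n) : Prop :=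
  exists (e : m = n) (P : 'M[K]_n), P \in unitmx /\
    L' = [set P *m castmx (e, e) X *m P^T | X in L]%classic.

Section NormalForms.
Variable K : numFieldType.
Implicit Types x y z w : K.

Definition diag2 m n (A : 'M[K]_m) (B : 'M[K]_n) : 'M[K]_(m + n) :=
  block_mx A 0 0 B.

Definition mx_of_rows k (s : seq (seq K)) : 'M[K]_k :=
  \matrix_(i, j) (nth [::] s i)`_j.

Definition antidiag k : 'M[K]_k := \matrix_(i, j) ((i + j).+1 == k)%:R.

Definition family4 n (M : K -> K -> K -> K -> 'M[K]_n) : set 'M[K]_n :=
  [set X | exists x y z w, X = M x y z w]%classic.

Definition hankel2 x y := mx_of_rows 2 [:: [:: y; x]; [:: x; 0]].
Definition hankel3 x y z :=
  mx_of_rows 3 [:: [:: z; y; x]; [:: y; x; 0]; [:: x; 0; 0]].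
Definition hankel4 x y z w :=
  mx_of_rows 4 [:: [:: w; z; y; x]; [:: z; y; x; 0];
                   [:: y; x; 0; 0]; [:: x; 0; 0; 0]].
Definition skew2 : 'M[K]_2 := mx_of_rows 2 [:: [:: 0; 1]; [:: -1; 0]].

Local Notation "A '|+|' B" := (diag2 A B) (at level 55, right associativity).
Local Notation "''Id_' k" := (1%:M : 'M[K]_k) (at level 8, k at level 2).

Definition A1 k1 k2 k3 k4 := family4 (fun x y z w =>
  x *: 'Id_(k1 + k2 + k3 + k4) |+| y *: 'Id_(k2 + k3 + k4)
    |+| z *: 'Id_(k3 + k4) |+| w *: 'Id_k4).

Definition A2 k1 k2 l1 l2 := family4 (fun x y z w =>
  x *: 'Id_(k1 + k2) |+| y *: 'Id_k2
    |+| ('Id_l2 *t hankel2 z w) |+| z *: 'Id_l1).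

Definition A3 k1 k2 l1 l2 := family4 (fun x y z w =>
  ('Id_k2 *t hankel2 x y) |+| x *: 'Id_k1
    |+| ('Id_l2 *t hankel2 z w) |+| z *: 'Id_l1).

Definition A4 r k1 k2 k3 := family4 (fun x y z w =>
  w *: 'Id_r |+| ('Id_k3 *t hankel3 x y z)
    |+| ('Id_k2 *t hankel2 x y) |+| x *: 'Id_k1).

Definition A5 k1 k2 k3 k4 := family4 (fun x y z w =>
  ('Id_k4 *t hankel4 x y z w) |+| ('Id_k3 *t hankel3 x y z)
    |+| ('Id_k2 *t hankel2 x y) |+| x *: 'Id_k1).

Definition B1 k1 k2 := family4 (fun x y z w =>
  w *: 'Id_k1
    |+| (mx_of_rows 2 [:: [:: x; y]; [:: y; z]] *t 'Id_k2)).

Definition B2 r k l1 l2 := family4 (fun x y z w =>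
  w *: 'Id_r
    |+| block_mx (x *: antidiag l2) (z *: pid_mx k)
                 (z *: pid_mx k)    (y *: antidiag l2)
    |+| y *: 'Id_l1).

(* C1 q and C2 m k have sizes 4q and 2m; in C2 the half size m is written
   k * 2 + (m - k * 2), which equals m in the range 2k <= m where C2 is used. *)
Definition C1 q := family4 (fun x y z w =>
  block_mx (x *: 'Id_(q * 2)) (z *: 'Id_(q * 2) + w *: ('Id_q *t skew2))
           (z *: 'Id_(q * 2) + w *: ('Id_q *t (- skew2))) (y *: 'Id_(q * 2))).

Definition C2 m k := family4 (fun x y z w =>
  let J := antidiag (k * 2 + (m - k * 2)) in
  let N S := ('Id_k *t S) |+| (0 : 'M[K]_(m - k * 2)) in
  block_mx (x *: J) (z *: J + w *: N skew2)
           (z *: J + w *: N (- skew2)) (y *: J)).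

End NormalForms.

Arguments A1 : clear implicits.
Arguments A2 : clear implicits.
Arguments A3 : clear implicits.
Arguments A4 : clear implicits.
Arguments A5 : clear implicits.
Arguments B1 : clear implicits.
Arguments B2 : clear implicits.
Arguments C1 : clear implicits.
Arguments C2 : clear implicits.

(* Main.v *)
Require Import Defs.
From mathcomp Require Import all_boot all_order all_algebra.
From mathcomp Require Import qpoly mxtens complex.
From mathcomp Require Import classical_sets reals.
From mathcomp Require Import ring zify.

(** An embedding is a family of symmetric matrices f a, and congruence changes
    all of them by one P.  Put U = f 1.  The operators f a U^-1 are
    self-adjoint for the symmetric form U, and the Jordan product becomes the
    symmetrised product of operators.  A normal form is therefore a basis in
    which the form U and the operators have a prescribed shape, and the main
    tool is to split off a subspace that is stable under the operators and
    nondegenerate for U: its orthogonal complement is stable too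
    (orth_compl, cong_split), so one small model can be removed at a time.

    Products: the idempotent (1, 0) of A x B splits the space into two
    orthogonal stable parts, one carrying an embedding of A and the other an
    embedding of B (embeds_prod).  It remains to treat the factors.

    Truncated polynomials: the image of x gives a nilpotent self-adjoint
    operator T.  If m is the largest exponent with T^m <> 0, some vector u
    satisfies b(u, u T^j) = 0 for j < m and b(u, u T^m) = 1 (jet_vector).
    In the basis u, u T, ..., u T^m every power of T is a Hankel matrix, and
    induction removes all blocks of the largest size, then the next
    (jet_split).  The scalars are the case T = 0.

    Spin factors: the first generator is an involution, and its two eigenspaces
    are orthogonal while every other generator exchanges them, so it is given
    by a rectangular block B_i (spin_split).  If the second generator squares
    to 1, its block is an isometry between the eigenspaces; identifying them
    leaves one symmetric form W and, for a third generator, one alternating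
    form C with C W^-1 C = -W or 0 (spin_double).  These pairs are classified
    by splitting off planes (skew_involution), respectively spaces of
    dimension 4 made of two hyperbolic planes (skew_nilpotent).  If the second
    generator squares to 0, its block has isotropic images in both eigenspaces
    and is classified by splitting off one hyperbolic plane from each
    (isotropic_triple).

    Sizes: a change of basis is a rectangular matrix with a two-sided inverse.
    Equalities such as p + q = n then appear only when the congruence of
    spaces is deduced at the end (congruent_range). *)

Set Implicit Arguments.
Unset Strict Implicit.
Unset Printing Implicit Defensive.
Import Order.TTheory GRing.Theory Num.Theory.
Local Open Scope ring_scope.

(** * Congruent families of matrices *)

Section Congruence.
Variable K : numFieldType.

(** A change of basis between matrices whose sizes are equal only
    propositionally; see inverse_pair_size. *)
Definition inverse_pair m n (P : 'M[K]_(m, n)) (Q : 'M[K]_(n, m)) : Prop :=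
  P *m Q = 1%:M /\ Q *m P = 1%:M.

Lemma inverse_pair_sym m n (P : 'M[K]_(m, n)) Q : inverse_pair P Q -> inverse_pair Q P.
Proof. by case. Qed.

Lemma invpair1 n : inverse_pair (1%:M : 'M[K]_n) 1%:M.
Proof. by split; rewrite mulmx1. Qed.

Lemma inverse_pair_mul m n p (P : 'M[K]_(m, n)) Q (P' : 'M[K]_(n, p)) Q' :
  inverse_pair P Q -> inverse_pair P' Q' -> inverse_pair (P *m P') (Q' *m Q).
Proof.
case=> PQ QP [PQ' QP']; split.
  by rewrite mulmxA -(mulmxA P) PQ' mulmx1.
by rewrite mulmxA -(mulmxA Q') QP mulmx1.
Qed.

Lemma inverse_pair_tr m n (P : 'M[K]_(m, n)) Q : inverse_pair P Q -> inverse_pair Q^T P^T.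
Proof. by case=> PQ QP; split; rewrite -trmx_mul ?PQ ?QP trmx1. Qed.

Lemma inverse_pair_diag m n m' n' (P : 'M[K]_(m, n)) Q (P' : 'M[K]_(m', n')) Q' :
  inverse_pair P Q -> inverse_pair P' Q' ->
  inverse_pair (block_mx P 0 0 P') (block_mx Q 0 0 Q').
Proof.
case=> PQ QP [PQ' QP']; split; rewrite mulmx_block !(mulmx0, mul0mx, addr0, add0r).
  by rewrite PQ PQ' -scalar_mx_block.
by rewrite QP QP' -scalar_mx_block.
Qed.

Lemma inverse_pair_size m n (P : 'M[K]_(m, n)) Q : inverse_pair P Q -> m = n.
Proof.
case=> PQ QP; apply/eqP; rewrite eqn_leq.
rewrite -{1}(mxrank1 K m) -PQ (leq_trans (mxrankM_maxr _ _)) ?rank_leq_row //=.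
by rewrite -{1}(mxrank1 K n) -QP (leq_trans (mxrankM_maxr _ _)) ?rank_leq_row.
Qed.

Lemma inverse_pair_unit n (P Q : 'M[K]_n) : inverse_pair P Q -> P \in unitmx.
Proof. by case=> /mulmx1_unit[]. Qed.

Lemma congr_unit m n (P : 'M[K]_(m, n)) Q U : inverse_pair P Q -> U \in unitmx ->
  P *m U *m P^T \in unitmx /\ invmx (P *m U *m P^T) = Q^T *m invmx U *m Q.
Proof.
move=> PQ uU; have [PQ1 QP1] := PQ; have [QPt PQt] := inverse_pair_tr PQ.
have h : (P *m U *m P^T) *m (Q^T *m invmx U *m Q) = 1%:M.
  rewrite !mulmxA -(mulmxA _ P^T) PQt mulmx1 -(mulmxA P) mulmxV //.
  by rewrite mulmx1.
have [uX _] := mulmx1_unit h; split=> //.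
by rewrite -[RHS](mulKmx uX) h mulmx1.
Qed.

(** Identities between products X U^-1 Y, hence all Jordan identities,
    pass to congruent families. *)
Lemma congr_prod m n (P : 'M[K]_(m, n)) Q U X Y : inverse_pair P Q -> U \in unitmx ->
  (P *m X *m P^T) *m invmx (P *m U *m P^T) *m (P *m Y *m P^T) =
  P *m (X *m invmx U *m Y) *m P^T.
Proof.
move=> PQ uU; have [_ ->] := congr_unit PQ uU.
have [PQ1 QP1] := PQ; have [QPt PQt] := inverse_pair_tr PQ.
rewrite !mulmxA -(mulmxA _ P^T) PQt mulmx1 -(mulmxA _ Q P) QP1 mulmx1.
by [].
Qed.

Lemma congr_sym m n (P : 'M[K]_(m, n)) (X : 'M_n) : X^T = X ->
  (P *m X *m P^T)^T = P *m X *m P^T.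
Proof. by move=> sX; rewrite !trmx_mul sX trmxK mulmxA. Qed.

(** One P serves the whole family: the common change of basis is what
    makes a congruence of parametrised spaces. *)
Definition cong (I : Type) m n (F : I -> 'M[K]_m) (G : I -> 'M[K]_n) : Prop :=
  exists P Q, inverse_pair P Q /\ forall i, G i = P *m F i *m P^T.

Lemma cong_eq I n (F G : I -> 'M[K]_n) : (forall i, F i = G i) -> cong F G.
Proof.
move=> FG; exists 1%:M, 1%:M; split; first exact: invpair1.
by move=> i; rewrite trmx1 mulmx1 mul1mx FG.
Qed.

Lemma cong_refl I n (F : I -> 'M[K]_n) : cong F F.
Proof. exact: cong_eq. Qed.

Lemma cong_trans I m n p (F : I -> 'M[K]_m) (G : I -> 'M[K]_n)
  (H : I -> 'M[K]_p) : cong F G -> cong G H -> cong F H.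
Proof.
move=> [P [Q [PQ FG]]] [P' [Q' [PQ' GH]]].
exists (P' *m P), (Q *m Q'); split; first exact: inverse_pair_mul.
by move=> i; rewrite GH FG trmx_mul !mulmxA.
Qed.

Lemma cong_sym I m n (F : I -> 'M[K]_m) (G : I -> 'M[K]_n) :
  cong F G -> cong G F.
Proof.
move=> [P [Q [PQ FG]]]; exists Q, P; split; first exact: inverse_pair_sym.
move=> i; rewrite FG; have [_ QP] := PQ; have [_ PQt] := inverse_pair_tr PQ.
by rewrite !mulmxA QP mul1mx -mulmxA PQt mulmx1.
Qed.

Lemma cong_size I m n (F : I -> 'M[K]_m) (G : I -> 'M[K]_n) :
  cong F G -> m = n.
Proof. by move=> [P [Q [/inverse_pair_size e _]]]; rewrite e. Qed.

Lemma cong_comp I J m n (F : I -> 'M[K]_m) (G : I -> 'M[K]_n) (h : J -> I) :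
  cong F G -> cong (fun j => F (h j)) (fun j => G (h j)).
Proof. by move=> [P [Q [PQ FG]]]; exists P, Q. Qed.

Lemma cong_diag I m n m' n' (F : I -> 'M[K]_m) (G : I -> 'M[K]_n)
  (F' : I -> 'M[K]_m') (G' : I -> 'M[K]_n') : cong F G -> cong F' G' ->
  cong (fun i => diag2 (F i) (F' i)) (fun i => diag2 (G i) (G' i)).
Proof.
move=> [P [Q [PQ FG]]] [P' [Q' [PQ' GH]]].
exists (block_mx P 0 0 P'), (block_mx Q 0 0 Q'); split.
  exact: inverse_pair_diag.
move=> i; rewrite /diag2 tr_block_mx !mulmx_block.
by rewrite !(trmx0, mulmx0, mul0mx, addr0, add0r) FG GH.
Qed.

Lemma cong_cast I m n (e : m = n) (F : I -> 'M[K]_m) :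
  cong F (fun i => castmx (e, e) (F i)).
Proof. by case: _ / e; apply: cong_eq => i; rewrite castmx_id. Qed.

(** A congruence between the images of a basis extends to the space that
    they span. *)
Lemma cong_lin I J m n (r : seq I) (c : J -> I -> K) (F : I -> 'M[K]_m)
  (G : I -> 'M[K]_n) : cong F G ->
  cong (fun j => \sum_(i <- r) c j i *: F i)
       (fun j => \sum_(i <- r) c j i *: G i).
Proof.
move=> [P [Q [PQ FG]]]; exists P, Q; split=> // j.
rewrite mulmx_sumr mulmx_suml; apply: eq_bigr => i _.
by rewrite FG -scalemxAr -scalemxAl.
Qed.

Lemma cong_diagA I m n p (F : I -> 'M[K]_m) (G : I -> 'M[K]_n)
  (H : I -> 'M[K]_p) :
  cong (fun i => diag2 (F i) (diag2 (G i) (H i)))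
       (fun i => diag2 (diag2 (F i) (G i)) (H i)).
Proof.
apply: cong_trans (cong_cast (addnA m n p) _) _; apply: cong_eq => i.
rewrite /diag2.
have := @block_mxA _ m n p m n p (F i) 0 0 0 (G i) 0 0 0 (H i).
rewrite !row_mx0 !col_mx0 => /= ->.
by apply: (canLR (castmxKV _ _)); congr castmx; congr pair; apply: eq_irrelevance.
Qed.

Lemma cong_diagC I m n (F : I -> 'M[K]_m) (G : I -> 'M[K]_n) :
  cong (fun i => diag2 (F i) (G i)) (fun i => diag2 (G i) (F i)).
Proof.
exists (block_mx 0 1%:M 1%:M 0), (block_mx 0 1%:M 1%:M 0); split.
  by split; rewrite mulmx_block !(mulmx0, mul0mx, addr0, add0r, mulmx1)
    -scalar_mx_block.
move=> i; rewrite /diag2 tr_block_mx !mulmx_block.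
by rewrite !(trmx0, trmx1, mulmx0, mul0mx, addr0, add0r, mulmx1, mul1mx).
Qed.

Lemma cong_diag0l I n (F : I -> 'M[K]_0) (G : I -> 'M[K]_n) :
  cong G (fun i => diag2 (F i) (G i)).
Proof.
apply: cong_eq => i; apply/matrixP => a b.
transitivity (diag2 (F i) (G i) (rshift 0 a) (rshift 0 b)).
  by rewrite /diag2 block_mxEdr.
by congr (_ _ _); apply: val_inj.
Qed.

Lemma unit_diag m n (A : 'M[K]_m) (B : 'M[K]_n) :
  diag2 A B \in unitmx -> A \in unitmx /\ B \in unitmx.
Proof. by rewrite block_diag_mx_unit => /andP. Qed.

Lemma diag_prod m n (U X Y : 'M[K]_m) (U' X' Y' : 'M[K]_n) :
  diag2 U U' \in unitmx ->
  diag2 X X' *m invmx (diag2 U U') *m diag2 Y Y' =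
  diag2 (X *m invmx U *m Y) (X' *m invmx U' *m Y').
Proof.
move=> uU; rewrite /diag2 (invmx_block_diag uU) !mulmx_block.
by rewrite !(mulmx0, mul0mx, addr0, add0r).
Qed.

Lemma diag_inj m n (A A' : 'M[K]_m) (B B' : 'M[K]_n) :
  diag2 A B = diag2 A' B' -> A = A' /\ B = B'.
Proof. by case/eq_block_mx. Qed.

(** The permutation matrix of a relabelling s of the basis. *)
Definition relabel m n (s : 'I_m -> 'I_n) : 'M[K]_(n, m) :=
  \matrix_(i, j) (i == s j)%:R.

Lemma relabel_invpair m n (s : 'I_m -> 'I_n) : m = n -> injective s ->
  inverse_pair (relabel s) (relabel s)^T.
Proof.
move=> emn; subst n => s_inj.
suff PtP : (relabel s)^T *m relabel s = 1%:M by split=> //; exact: mulmx1C.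
apply/matrixP => i j; rewrite !mxE (bigD1 (s i)) //= !mxE eqxx mul1r big1.
  by rewrite addr0 (inj_eq s_inj).
by move=> k /negPf ki; rewrite !mxE ki mul0r.
Qed.

Lemma relabelE m n m' n' (s : 'I_m -> 'I_n) (t : 'I_m' -> 'I_n')
  (X : 'M[K]_(m, m')) (Y : 'M_(n, n')) :
  m = n -> m' = n' -> injective s -> injective t ->
  (forall a b, Y (s a) (t b) = X a b) -> Y = relabel s *m X *m (relabel t)^T.
Proof.
move=> e e'; subst n n' => s_inj t_inj YX.
have [s' _ s'K] : bijective s by apply: injF_bij.
have [t' _ t'K] : bijective t by apply: injF_bij.
apply/matrixP => a b; rewrite -(s'K a) -(t'K b) YX mxE (bigD1 (t' b)) //= big1.
  rewrite !mxE eqxx mulr1 addr0 (bigD1 (s' a)) //= big1 ?addr0.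
    by rewrite !mxE eqxx mul1r.
  by move=> k /negPf; rewrite !mxE (inj_eq s_inj) eq_sym => ->; rewrite mul0r.
by move=> k /negPf; rewrite !mxE (inj_eq t_inj) eq_sym => ->; rewrite mulr0.
Qed.

Lemma cong_reindex I m n (F : I -> 'M[K]_m) (G : I -> 'M[K]_n)
  (s : 'I_m -> 'I_n) : m = n -> injective s ->
  (forall i a b, G i (s a) (s b) = F i a b) -> cong F G.
Proof.
move=> e s_inj FG; exists (relabel s), (relabel s)^T.
by split=> [|i]; [exact: relabel_invpair | apply: relabelE].
Qed.

(** With G the Gram matrix of P1, the operator U P1^T G^-1 P1 projects
    onto the row space of P1 along its orthogonal, which is the row space of
    the complementary projection E below. *)
Lemma orth_compl d n (U : 'M[K]_n) (P1 : 'M[K]_(d, n)) : U^T = U ->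
  P1 *m U *m P1^T \in unitmx ->
  exists n2 (P2 : 'M[K]_(n2, n)) Q,
    inverse_pair (col_mx P1 P2) Q /\ P1 *m U *m P2^T = 0.
Proof.
move=> sU uG; set G := P1 *m U *m P1^T in uG.
pose N := kermx (U *m P1^T).
pose P2 := row_base N; exists _, P2.
pose E := 1%:M - U *m P1^T *m invmx G *m P1.
have EN : (E <= N)%MS.
  apply/sub_kermxP; rewrite mulmxBl mul1mx -!mulmxA (mulmxA P1) -/G.
  by rewrite mulVmx // mulmx1 subrr.
have /submxP[c Ec] : (E <= P2)%MS by rewrite eq_row_base.
have P2U : P2 *m (U *m P1^T) = 0.
  by apply/sub_kermxP; rewrite -/N /P2 eq_row_base.
exists (row_mx (U *m P1^T *m invmx G) c); split; last first.
  by apply: trmx_inj; rewrite trmx0 (trmx_mul _ P2^T) trmxK trmx_mul sU.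
have free2 (k : nat) (x : 'M_(k, _)) : x *m P2 = 0 -> x = 0.
  by move=> x0; apply: (row_free_inj (row_base_free N)); rewrite -/P2 x0 mul0mx.
have P1c : P1 *m c = 0.
  apply: free2; rewrite -mulmxA -Ec mulmxBr mulmx1 !mulmxA -/G mulmxV //.
  by rewrite mul1mx subrr.
have P2c : P2 *m c = 1%:M.
  apply: (row_free_inj (row_base_free N)); rewrite -/P2 -mulmxA -Ec mulmxBr.
  by rewrite mulmx1 mul1mx !mulmxA -[P2 *m U *m _]mulmxA P2U !mul0mx subr0.
split; last by rewrite mul_row_col -Ec addrC subrK.
rewrite mul_col_row P1c P2c !mulmxA -/G mulmxV // -[P2 *m U *m _]mulmxA P2U.
by rewrite mul0mx -scalar_mx_block.
Qed.

Lemma col_congr m n d (P1 : 'M[K]_(m, d)) (P2 : 'M_(n, d)) (X : 'M_d) :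
  col_mx P1 P2 *m X *m (col_mx P1 P2)^T =
  block_mx (P1 *m X *m P1^T) (P1 *m X *m P2^T)
           (P2 *m X *m P1^T) (P2 *m X *m P2^T).
Proof. by rewrite tr_col_mx mul_col_mx mul_col_row. Qed.

(** The adjoint of F_i U^-1 for the form U is (F_i)^T U^-1.  When P1 is
    stable under both, its orthogonal is stable as well, which kills the two
    off-diagonal blocks. *)
Lemma cong_split I d n (F : I -> 'M[K]_n) (U : 'M_n) (P1 : 'M[K]_(d, n)) :
  U^T = U -> P1 *m U *m P1^T \in unitmx ->
  (forall i, exists M, P1 *m F i = M *m P1 *m U) ->
  (forall i, exists M, P1 *m (F i)^T = M *m P1 *m U) ->
  exists n2 (F2 : I -> 'M_n2),
    cong F (fun i => diag2 (P1 *m F i *m P1^T) (F2 i)).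
Proof.
move=> sU uG inv1 inv2; have [n2 [P2 [Q [PQ orth]]]] := orth_compl sU uG.
exists n2, (fun i => P2 *m F i *m P2^T), (col_mx P1 P2), Q; split=> // i.
rewrite col_congr /diag2; congr block_mx; last first.
- apply: trmx_inj; have [M eM] := inv2 i.
  rewrite trmx0 !trmx_mul trmxK mulmxA eM -[M *m P1 *m U]mulmxA -mulmxA orth.
  by rewrite mulmx0.
- by have [M ->] := inv1 i; rewrite -[M *m P1 *m U]mulmxA -mulmxA orth mulmx0.
Qed.

End Congruence.

(** * Nondegenerate symmetric forms *)

Section Diagonalise.
Variable K : numFieldType.
Hypothesis sqrtK : forall x : K, exists y, y ^+ 2 = x.

Lemma neq0_entry m n (X : 'M[K]_(m, n)) : X != 0 -> exists i j, X i j != 0.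
Proof.
move=> X0; have /existsP[i /existsP[j Xij]] : [exists i, exists j, X i j != 0].
  apply: contraNT X0; rewrite negb_exists => /forallP h.
  apply/eqP/matrixP => i j; rewrite mxE; apply/eqP.
  by have := h i; rewrite negb_exists => /forallP/(_ j); rewrite negbK.
by exists i, j.
Qed.

(** Polarisation: if the quadratic form of X vanished at e_i, e_j and
    e_i + e_j, then 2 X_ij = 0.  A square root normalises the nonzero value. *)
Lemma exists_unit_vector n (X : 'M[K]_n) : X^T = X -> X != 0 ->
  exists u : 'rV_n, u *m X *m u^T = 1%:M.
Proof.
move=> sX X0; pose q (u v : 'rV_n) := (u *m X *m v^T) 0 0.
have qC u v : q u v = q v u.
  by rewrite /q -[v *m X *m u^T]trmxK [in RHS]mxE !trmx_mul trmxK sX mulmxA.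
have qDl u v w : q (u + v) w = q u w + q v w by rewrite /q !mulmxDl mxE.
have qDr u v w : q u (v + w) = q u v + q u w by rewrite qC qDl !(qC u).
have [u qu] : exists u, q u u != 0.
  have [i [j Xij]] := neq0_entry X0.
  pose e k : 'rV[K]_n := delta_mx 0 k.
  have qe k l : q (e k) (e l) = X k l.
    by rewrite /q -rowE trmx_delta -colE !mxE.
  have [qi|] := eqVneq (q (e i) (e i)) 0; last by exists (e i).
  have [qj|] := eqVneq (q (e j) (e j)) 0; last by exists (e j).
  exists (e i + e j); rewrite qDl !qDr qi qj add0r addr0 (qC (e j)) qe.
  by rewrite -mulr2n mulrn_eq0.
have [y yq] := sqrtK (q u u)^-1.
exists (y *: u); rewrite linearZ /= -!scalemxAl -scalemxAr scalerA -expr2 yq.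
by rewrite [u *m X *m _]mx11_scalar -/(q u u) scale_scalar_mx mulVf.
Qed.

(** Unit vectors are split off one at a time. *)
Lemma cong_one n (U : 'M[K]_n) : U^T = U -> U \in unitmx ->
  cong (fun _ : unit => U) (fun _ => 1%:M : 'M[K]_n).
Proof.
elim/ltn_ind: n U => n IH U sU uU.
have [n0|n_gt0] := posnP n.
  by subst n; apply: cong_eq => _; rewrite [LHS]flatmx0 [RHS]flatmx0.
have U0 : U != 0.
  apply: contraL uU => /eqP->; rewrite unitmxE.
  by case: n n_gt0 {IH U sU} => // n _; rewrite det0 unitr0.
have [u uUu] := exists_unit_vector sU U0.
have [|d|d|n2 [F2 cF]] := @cong_split K unit _ _ (fun _ => U) _ u sU.
- by rewrite uUu unitmx1.
- by exists 1%:M; rewrite mul1mx.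
- by exists 1%:M; rewrite sU mul1mx.
have en := cong_size cF; subst n.
(* The complement is again symmetric and invertible, as a block of a
   congruent of U. *)
have [P [Q [PQ /(_ tt) FP]]] := cF.
apply: (cong_trans cF); rewrite scalar_mx_block.
have uD : diag2 (u *m U *m u^T) (F2 tt) \in unitmx.
  by rewrite FP; have [] := congr_unit PQ uU.
have sD : (diag2 (u *m U *m u^T) (F2 tt))^T = diag2 (u *m U *m u^T) (F2 tt).
  by rewrite FP congr_sym.
apply: cong_diag; first by apply: cong_eq => _; rewrite uUu.
apply: (cong_trans _ (IH n2 _ (F2 tt) _ _)); first by apply: cong_eq => -[].
- by rewrite addnC addn1.
- by move: sD; rewrite /diag2 tr_block_mx => /eq_block_mx[].
- by have [] := unit_diag uD.
Qed.

Lemma cong_sym_unit n (U W : 'M[K]_n) : U^T = U -> U \in unitmx ->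
  W^T = W -> W \in unitmx -> cong (fun _ : unit => U) (fun _ => W).
Proof.
by move=> sU uU sW uW; apply: cong_trans (cong_one sU uU) (cong_sym (cong_one sW uW)).
Qed.

End Diagonalise.

(** * Nilpotent self-adjoint operators and Hankel blocks *)

Section Jets.
Variable K : numFieldType.
Hypothesis sqrtK : forall x : K, exists y, y ^+ 2 = x.

(** With U = F 0 and T = F 1 U^-1, the third condition gives F j = T^j U:
    these are the images of the powers of x under an embedding of the
    polynomials truncated at x^m. *)
Definition jet m n (F : nat -> 'M[K]_n) : Prop :=
  [/\ F 0%N \in unitmx, forall j, (F j)^T = F j,
      forall i j, F (i + j)%N = F i *m invmx (F 0%N) *m F j
    & F m = 0].

(** The coefficient of the j-th indeterminate in a Hankel block of size m. *)
Definition hankel_unit m j : 'M[K]_m := \matrix_(a, b) ((a + b + j).+1 == m)%:R.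

Lemma jet_cong m n p (F : nat -> 'M[K]_n) (G : nat -> 'M[K]_p) :
  cong F G -> jet m F -> jet m G.
Proof.
move=> [P [Q [PQ FG]]] [uF sF mF F0]; split.
- by rewrite FG; have [] := congr_unit PQ uF.
- by move=> j; rewrite FG congr_sym.
- by move=> i j; rewrite !FG (congr_prod _ _ PQ uF) mF.
- by rewrite FG F0 mulmx0 mul0mx.
Qed.

Lemma jet_diag m n p (F : nat -> 'M[K]_n) (G : nat -> 'M[K]_p) :
  jet m (fun j => diag2 (F j) (G j)) -> jet m G.
Proof.
move=> [uF sF mF F0]; split.
- by have [] := unit_diag uF.
- by move=> j; have := sF j; rewrite /diag2 tr_block_mx => /eq_block_mx[].
- by move=> i j; have := mF i j; rewrite diag_prod // => /diag_inj[].
- by move: F0; rewrite /diag2 -[RHS]block_mx0 => /eq_block_mx[].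
Qed.

Lemma jet_ge m n (F : nat -> 'M[K]_n) j : jet m F -> (m <= j)%N -> F j = 0.
Proof.
by move=> [uF sF mF F0] mj; rewrite -(subnKC mj) mF F0 !mul0mx.
Qed.

Lemma tr_antidiag m : (antidiag K m)^T = antidiag K m.
Proof. by apply/matrixP => i j; rewrite !mxE addnC. Qed.

Lemma antidiag_unit m : antidiag K m \in unitmx.
Proof.
suff h : antidiag K m *m antidiag K m = 1%:M by case/mulmx1_unit: h.
apply/matrixP => i j; rewrite !mxE (bigD1 (rev_ord i)) //= !mxE big1.
  rewrite addr0 /=; have -> : ((i + (m - i.+1)).+1 == m)%N by have := ltn_ord i; lia.
  rewrite mul1r; congr (nat_of_bool _)%:R.
  by rewrite -val_eqE /=; have := ltn_ord i; have := ltn_ord j; lia.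
move=> k ki; rewrite !mxE; have -> : ((i + k).+1 == m)%N = false.
  apply: contraNF ki => /eqP ikm; apply/eqP/val_inj => /=.
  by have := ltn_ord i; have := ltn_ord k; lia.
by rewrite mul0r.
Qed.

(** Start with u T^m U u^T = 1.  Going down from i = m - 1 to 0, replace u
    by u + b u T^(m-i).  This adds 2 b to c = u T^i U u^T, so b = -c/2
    cancels it; the values with larger exponents do not move because
    T^(m+1) = 0. *)
Lemma jet_vector m n (F : nat -> 'M[K]_n) : jet m.+1 F -> F m != 0 ->
  exists u : 'rV_n, forall j, u *m F j *m u^T = (j == m)%:R%:M.
Proof.
move=> jF Fm; have [uF sF mF F0] := jF.
pose V := invmx (F 0%N).
suff h k : (k <= m)%N -> exists u : 'rV_n,
    forall j, (m - k <= j)%N -> u *m F j *m u^T = (j == m)%:R%:M.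
  by have [u hu] := h m (leqnn m); exists u => j; apply: hu; lia.
elim: k => [_|k IH km].
  have [u hu] := exists_unit_vector sqrtK (sF m) Fm.
  exists u => j; rewrite subn0 leq_eqVlt => /predU1P[<-|mj].
    by rewrite eqxx hu.
  by rewrite (jet_ge jF mj) mulmx0 mul0mx gtn_eqF // -scalemx1 scale0r.
have [u hu] := IH (ltnW km).
pose i := (m - k.+1)%N; pose c := (u *m F i *m u^T) 0 0.
pose d := k.+1; pose b := - c / 2.
have VT : V^T = V by rewrite /V trmx_inv sF.
exists (u + b *: (u *m F d *m V)) => j ij.
have sV i1 j1 : F i1 *m V *m F j1 = F (i1 + j1)%N by rewrite mF.
have -> : (u + b *: (u *m F d *m V)) *m F j *m (u + b *: (u *m F d *m V))^T =
  u *m F j *m u^T + (2 * b) *: (u *m F (j + d)%N *m u^T)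
  + b ^+ 2 *: (u *m F (d + j + d)%N *m u^T).
  rewrite linearD /= linearZ /= !trmx_mul VT sF.
  rewrite !(mulmxDl, mulmxDr) -!(scalemxAl, scalemxAr).
  have -> : u *m F j *m (V *m (F d *m u^T)) = u *m F (j + d)%N *m u^T.
    by rewrite -sV !mulmxA.
  have -> : u *m F d *m V *m F j *m u^T = u *m F (j + d)%N *m u^T.
    by rewrite addnC -sV !mulmxA.
  have -> : u *m F d *m V *m F j *m (V *m (F d *m u^T)) =
            u *m F (d + j + d)%N *m u^T by rewrite -!sV !mulmxA.
  rewrite scalerA -expr2 addrA; congr (_ + _); rewrite -addrA -scalerDl.
  by congr (_ + _ *: _); ring.
have idm : (i + d = m)%N by rewrite /i /d subnK.
rewrite (@jet_ge _ _ _ (d + j + d) jF); last by move: idm ij; rewrite /i /d; lia.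
rewrite mulmx0 mul0mx scaler0 addr0.
have [->|ji] := eqVneq j i.
  rewrite idm (hu m) ?leq_subr // eqxx [u *m F i *m _]mx11_scalar -/c.
  have /negPf-> : i != m by rewrite /i; lia.
  rewrite scale_scalar_mx -raddfD /=; congr (_%:M); rewrite /b.
  by field.
rewrite (@jet_ge _ _ _ (j + d) jF); last by move: ji idm ij; rewrite /i /d; lia.
by rewrite mulmx0 mul0mx scaler0 addr0 hu //; move: ji ij; rewrite /i; lia.
Qed.

(** For u as in jet_vector, the vectors u T^a have Gram matrices
    u T^(a+j+b) U u^T, which are the Hankel coefficients; their span is
    stable under T and, J_(m+1) being invertible, nondegenerate. *)
Lemma jet_split1 m n (F : nat -> 'M[K]_n) : jet m.+1 F -> F m != 0 ->
  exists n2 (F2 : nat -> 'M_n2),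
    cong F (fun j => diag2 (hankel_unit m.+1 j) (F2 j)) /\ jet m.+1 F2.
Proof.
move=> jF Fm; have [u hu] := jet_vector jF Fm; have [uF sF mF F0] := jF.
pose V := invmx (F 0%N).
have VT : V^T = V by rewrite /V trmx_inv sF.
pose P1 : 'M_(m.+1, n) := \matrix_(a < m.+1) (u *m F a *m V).
have rP1 a : row a P1 = u *m F a *m V by rewrite rowK.
have gram j : P1 *m F j *m P1^T = hankel_unit m.+1 j.
  apply/matrixP => a b.
  have -> : (P1 *m F j *m P1^T) a b = (row a P1 *m F j *m (row b P1)^T) 0 0.
    by rewrite -row_mul !mxE; apply: eq_bigr => k _; rewrite !mxE.
  rewrite !rP1 !trmx_mul VT sF !mulmxA.
  have step x y : u *m F x *m V *m F y = u *m F (x + y)%N by rewrite mF !mulmxA.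
  rewrite !step hu !mxE eqxx mulr1n; congr (nat_of_bool _)%:R.
  by lia.
have inv j : exists M, P1 *m F j = M *m P1 *m F 0%N.
  exists (\matrix_(a < m.+1, b < m.+1) ((b : nat) == (a + j)%N)%:R).
  apply/row_matrixP => a; rewrite !row_mul rP1 -!mulmxA (mulmxA (F a)) -mF.
  have [ajm|ajm] := ltnP (a + j) m.+1; last first.
    rewrite (jet_ge jF ajm) mulmx0 mulmxA.
    rewrite (_ : row a _ = 0) ?mul0mx //; apply/rowP => l; rewrite !mxE.
    by rewrite (_ : (_ == _) = false) //; have := ltn_ord l; lia.
  have -> : row a (\matrix_(a < m.+1, b < m.+1) ((b : nat) == (a + j)%N)%:R) =
            delta_mx 0 (Ordinal ajm) :> 'rV[K]_m.+1.
    by apply/rowP => b; rewrite !mxE.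
  by rewrite mulmxA -rowE rP1 -(mulmxA _ V) mulVmx // mulmx1.
have [|j|j|n2 [F2 cF]] := @cong_split K nat _ _ F (F 0%N) P1 (sF 0%N).
- rewrite gram; have <- : antidiag K m.+1 = hankel_unit m.+1 0 by
    apply/matrixP => a b; rewrite !mxE addn0.
  exact: antidiag_unit.
- exact: inv.
- by rewrite sF; exact: inv.
have cF' : cong F (fun j => diag2 (hankel_unit m.+1 j) (F2 j)).
  by apply: (cong_trans cF); apply: cong_eq => j; rewrite gram.
exists n2, F2; split=> //; exact: jet_diag (jet_cong cF' jF).
Qed.

Lemma tens1S k d (H : 'M[K]_d) :
  (1%:M : 'M_k.+1) *t H = diag2 H ((1%:M : 'M_k) *t H) :> 'M_(d + k * d).
Proof.
have el (i : 'I_d) : lshift (k * d) i = mxtens_index (ord0 : 'I_k.+1, i).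
  by apply: val_inj; rewrite /= mul0n.
have er (a : 'I_k) (i : 'I_d) :
    rshift d (mxtens_index (a, i)) = mxtens_index (lift ord0 a : 'I_k.+1, i).
  by apply: val_inj; rewrite /= /bump /= add1n mulSn addnA.
have tE (a b : 'I_k.+1) (i j : 'I_d) :
    ((1%:M : 'M[K]_k.+1) *t H : 'M_(d + k * d)) (mxtens_index (a, i))
       (mxtens_index (b, j)) = (1%:M : 'M_k.+1) a b * H i j by exact: tensmxE.
apply/matrixP => x y; rewrite /diag2.
case: (split_ordP x) => [i ->|x' ->]; last case: (mxtens_indexP x') => a i;
  (case: (split_ordP y) => [j ->|y' ->]; last case: (mxtens_indexP y') => b j).
- by rewrite block_mxEul (el i) (el j) tE mxE eqxx mul1r.
- by rewrite block_mxEur (el i) (er b j) tE !mxE mul0r.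
- by rewrite block_mxEdl (el j) (er a i) tE !mxE mul0r.
- by rewrite block_mxEdr (er a i) (er b j) tE tensmxE !mxE (inj_eq lift_inj).
Qed.

(** Blocks of the largest size are removed until T^m vanishes, so that
    iterating over m lists the blocks by decreasing size. *)
Lemma jet_split m n (F : nat -> 'M[K]_n) : jet m.+1 F ->
  exists k n2 (F2 : nat -> 'M_n2), [/\
    cong F (fun j => diag2 ((1%:M : 'M_k) *t hankel_unit m.+1 j) (F2 j)),
    jet m F2 & (F m != 0 -> (0 < k)%N)].
Proof.
elim/ltn_ind: n F => n IH F jF.
have [Fm|Fm] := eqVneq (F m) 0.
  exists 0%N, n, F; split=> //; first exact: (cong_diag0l
    (fun j => (1%:M : 'M[K]_0) *t hankel_unit m.+1 j : 'M[K]_0) F).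
  by have [uF sF mF F0] := jF.
have [n2 [F2 [cF jF2]]] := jet_split1 jF Fm.
have en := cong_size cF; subst n.
have [|k [n3 [F3 [cF2 jF3 _]]]] := IH n2 _ F2 jF2; first by rewrite addSn ltnS leq_addl.
exists k.+1, n3, F3; split=> //.
apply: (cong_trans cF); apply: (cong_trans (cong_diag (cong_refl _) cF2)).
apply: (cong_trans (cong_diagA _ _ _)); apply: cong_eq => j.
by rewrite -tens1S.
Qed.

End Jets.

(** * Embeddings and their Peirce decomposition *)

Section Embeddings.
Variable K : numFieldType.

(** The conditions on an injective morphism, stated for its underlying
    family of matrices: the unit U is recovered as f 1, so that nothing
    refers to the type of symmetric matrices attached to U and the conditions
    pass to congruent families and to diagonal blocks. *)
Definition embeds (A : jordanAlg K) n (f : A -> 'M[K]_n) : Prop :=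
  [/\ (forall a x y, f (a *: x + y) = a *: f x + f y) /\ injective f,
      forall x, (f x)^T = f x, f (jone A) \in unitmx
    & forall x y, f (jmul x y) = 2^-1 *: (f x *m invmx (f (jone A)) *m f y
                                   + f y *m invmx (f (jone A)) *m f x)].

Lemma embeds_cong (A : jordanAlg K) m n (f : A -> 'M[K]_m) (g : A -> 'M[K]_n) :
  cong f g -> embeds f -> embeds g.
Proof.
move=> [P [Q [PQ fg]]] [[lf injf] sf uf mf]; split.
- split=> [a x y|x y].
    by rewrite !fg lf mulmxDr mulmxDl -scalemxAr -scalemxAl.
  rewrite !fg => exy; apply: injf.
  have [PQ1 QP1] := PQ; have [_ QPt] := inverse_pair_tr PQ.
  have back X : Q *m (P *m X *m P^T) *m Q^T = X.
    by rewrite !mulmxA QP1 mul1mx -mulmxA QPt mulmx1.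
  by rewrite -[LHS]back exy back.
- by move=> x; rewrite fg congr_sym.
- by rewrite fg; have [] := congr_unit PQ uf.
- move=> x y; rewrite !fg !(congr_prod _ _ PQ uf) mf -scalemxAr -scalemxAl.
  by rewrite mulmxDr mulmxDl.
Qed.

Lemma embeds0 (A : jordanAlg K) n (f : A -> 'M[K]_n) : embeds f -> f 0 = 0.
Proof.
by case=> [[lf _] _ _ _]; have := lf (-1) 0 0; rewrite !scaleN1r oppr0 add0r addNr.
Qed.

Lemma embedsZ (A : jordanAlg K) n (f : A -> 'M[K]_n) a x :
  embeds f -> f (a *: x) = a *: f x.
Proof.
by move=> ef; have [[lf _] _ _ _] := ef; rewrite -[a *: x]addr0 lf embeds0 ?addr0.
Qed.

Lemma embedsD (A : jordanAlg K) n (f : A -> 'M[K]_n) x y :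
  embeds f -> f (x + y) = f x + f y.
Proof. by case=> [[lf _] _ _ _]; have := lf 1 x y; rewrite !scale1r. Qed.

Lemma embeds_sum (A : jordanAlg K) n (f : A -> 'M[K]_n) I (r : seq I)
  (c : I -> K) (e : I -> A) : embeds f ->
  f (\sum_(i <- r) c i *: e i) = \sum_(i <- r) c i *: f (e i).
Proof.
move=> ef; have [[lf _] _ _ _] := ef.
elim: r => [|i r IH]; first by rewrite !big_nil embeds0.
by rewrite !big_cons lf IH.
Qed.

Lemma jmul0 (A : jordanAlg K) (x : A) : jmul x 0 = 0.
Proof.
rewrite jmulC; have := @jmulP _ A (-1) 0 0 x.
by rewrite scaleN1r oppr0 addr0 scaleN1r addNr.
Qed.

Lemma embeds_sq (A : jordanAlg K) n (f : A -> 'M[K]_n) x : embeds f ->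
  f (jmul x x) = f x *m invmx (f (jone A)) *m f x.
Proof.
by case=> [_ _ _ ->]; rewrite -mulr2n -scaler_nat scalerA mulVf ?scale1r ?pnatr_eq0.
Qed.

Lemma idem_split n (E : 'M[K]_n) : E *m E = E ->
  exists p q (P1 : 'M[K]_(p, n)) (P2 : 'M[K]_(q, n)) Q,
    [/\ inverse_pair (col_mx P1 P2) Q, P1 *m E = P1 & P2 *m E = 0].
Proof.
move=> EE; pose F := 1%:M - E.
have EF : E *m F = 0 by rewrite mulmxBr mulmx1 EE subrr.
have FE : F *m E = 0 by rewrite mulmxBl mul1mx EE subrr.
have FF : F *m F = F by rewrite {1}/F mulmxBl mul1mx EF subr0.
have [c1 e1] : exists c, E = c *m row_base E.
  by apply/submxP; rewrite eq_row_base.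
have [c2 e2] : exists c, F = c *m row_base F.
  by apply/submxP; rewrite eq_row_base.
have [d1 f1] : exists d, row_base E = d *m E.
  by apply/submxP; rewrite eq_row_base.
have [d2 f2] : exists d, row_base F = d *m F.
  by apply/submxP; rewrite eq_row_base.
have i1 := row_free_inj (row_base_free E).
have i2 := row_free_inj (row_base_free F).
move: (row_base E) (row_base F) c1 c2 d1 d2 e1 e2 f1 f2 i1 i2.
move=> P1 P2 c1 c2 d1 d2 e1 e2 f1 f2 i1 i2.
have P1E : P1 *m E = P1 by rewrite f1 -mulmxA EE.
have P2F : P2 *m F = P2 by rewrite f2 -mulmxA FF.
have P2E : P2 *m E = 0 by rewrite f2 -mulmxA FE mulmx0.
have P1F : P1 *m F = 0 by rewrite f1 -mulmxA EF mulmx0.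
exists _, _, P1, P2, (row_mx c1 c2); split=> //; split.
  rewrite mul_col_row [RHS]scalar_mx_block; congr block_mx.
  - by apply: i1; rewrite -mulmxA -e1 mul1mx.
  - by apply: i2; rewrite -mulmxA -e2 mul0mx.
  - by apply: i1; rewrite -mulmxA -e1 mul0mx.
  - by apply: i2; rewrite -mulmxA -e2 mul1mx.
by rewrite mul_row_col -e1 -e2 addrC subrK.
Qed.

(** Peirce decomposition.  Let E = f (1, 0) U^-1, an idempotent.  Since
    (1, 0) is neutral for (a, 0) and kills (0, b), the product rule gives
    f (a, 0) = E f (a, 0) and E f (0, b) = 0.  In a basis adapted to the
    image and the kernel of E the two families occupy different diagonal
    blocks. *)
Lemma embeds_prod (A B : jordanAlg K) n (f : prodJ A B -> 'M[K]_n) : embeds f ->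
  exists p q (f1 : A -> 'M_p) (f2 : B -> 'M_q), [/\ embeds f1, embeds f2
    & cong f (fun x => diag2 (f1 x.1) (f2 x.2))].
Proof.
move=> ef; have [[lf injf] sf uf mf] := ef.
set U := f (jone _) in uf mf; pose V := invmx U.
have jl0 (C : jordanAlg K) (x : C) : jmul 0 x = 0 by rewrite jmulC jmul0.
pose e : prodJ A B := (jone A, 0); have [E defE] : exists E, E = f e *m V by eexists.
have VT : V^T = V by rewrite /V trmx_inv sf.
have ET : E^T = V *m f e by rewrite defE trmx_mul sf VT.
have fe : f e = E *m f e.
  rewrite defE.
  rewrite -{1}[e](_ : jmul e e = e) ?embeds_sq //.
  by rewrite /= /prod_jmul /= jmul1 jl0.
have EE : E *m E = E by rewrite {2}defE mulmxA -fe.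
have two0 : 2 != 0 :> K by rewrite pnatr_eq0.
have half (X : 'M[K]_n) Y Z : X = 2^-1 *: (Y + Z) -> X + X = Y + Z.
  by move=> ->; rewrite -mulr2n -scaler_nat scalerA mulfV // scale1r.
have fA a : f (a, 0) = E *m f (a, 0).
  have /half h : f (a, 0) = 2^-1 *: (E *m f (a, 0) + f (a, 0) *m E^T).
    rewrite ET mulmxA defE -mf; congr f.
    by rewrite /= /prod_jmul /= jmul1 jl0.
  have h2 : E *m f (a, 0) = E *m f (a, 0) *m E^T.
    have := congr1 (mulmx E) h; rewrite !mulmxDr !mulmxA EE.
    by move/addrI.
  have h3 : f (a, 0) *m E^T = E *m f (a, 0).
    by rewrite -[LHS]trmxK trmx_mul trmxK sf [in LHS]h2 !trmx_mul trmxK sf mulmxA -h2.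
  move: h; rewrite h3 -!mulr2n => /(congr1 ( *:%R 2^-1)).
  by rewrite -!scaler_nat !scalerA mulVf // !scale1r.
have fB b : E *m f (0, b) = 0.
  have /half h : f (0 : prodJ A B) = 2^-1 *: (E *m f (0, b) + f (0, b) *m E^T).
    rewrite ET mulmxA defE -mf; congr f.
    by rewrite /= /prod_jmul /= jmul0 jl0.
  rewrite embeds0 // addr0 in h.
  have h2 : E *m f (0, b) = - (E *m f (0, b) *m E^T).
    have := congr1 (mulmx E) h; rewrite !mulmxDr !mulmxA EE mulmx0.
    by move/esym/eqP; rewrite addr_eq0 => /eqP.
  have h3 : f (0, b) *m E^T = E *m f (0, b).
    rewrite -[LHS]trmxK trmx_mul trmxK sf h2 linearN /= !trmx_mul trmxK sf.
    by rewrite mulmxA -h2.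
  move: h; rewrite h3 -!mulr2n => /esym/(congr1 ( *:%R 2^-1)).
  by rewrite scaler0 -!scaler_nat !scalerA mulVf // !scale1r.
have [p [q [P1 [P2 [Q [PQ P1E P2E]]]]]] := idem_split EE.
pose f1 a := P1 *m f (a, 0) *m P1^T; pose f2 b := P2 *m f (0, b) *m P2^T.
have cf : cong f (fun x => diag2 (f1 x.1) (f2 x.2)).
  exists (col_mx P1 P2), Q; split=> // -[a b] /=.
  have -> : f (a, b) = f (a, 0) + f (0, b).
    rewrite -(embedsD ((a, 0) : prodJ A B) (0, b) ef); congr f.
    by congr pair; rewrite /= ?addr0 ?add0r.
  rewrite mulmxDr mulmxDl !col_congr.
  have z1 : P2 *m f (a, 0) = 0 by rewrite fA mulmxA P2E mul0mx.
  have z1' : f (a, 0) *m P2^T = 0 by rewrite -sf -trmx_mul z1 trmx0.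
  have z2 : P1 *m f (0, b) = 0 by rewrite -P1E -mulmxA fB mulmx0.
  have z2' : f (0, b) *m P1^T = 0 by rewrite -sf -trmx_mul z2 trmx0.
  rewrite z1 z2 -!mulmxA z1' z2' !(mulmx0, mul0mx) add_block_mx !(addr0, add0r).
  by rewrite /diag2 /f1 /f2 !mulmxA.
have [[lg injg] sg ug mg] := embeds_cong cf ef.
exists p, q, f1, f2; split=> //; split.
- split=> [c x y|x y exy].
    by have := lg c (x, 0) (y, 0); rewrite /diag2 /= scale_block_mx add_block_mx
      => /eq_block_mx[].
  have : (x, 0) = (y, 0) :> prodJ A B by apply: injg; rewrite /= exy.
  by case.
- by move=> x; have := sg (x, 0); rewrite /diag2 tr_block_mx => /eq_block_mx[].
- by have [] := unit_diag ug.
- move=> x y; have := mg (x, 0) (y, 0); rewrite !diag_prod //= /diag2.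
  by rewrite add_block_mx scale_block_mx => /eq_block_mx[].
- split=> [c x y|x y exy].
    by have := lg c (0, x) (0, y); rewrite /diag2 /= scale_block_mx add_block_mx
      => /eq_block_mx[].
  have : (0, x) = (0, y) :> prodJ A B by apply: injg; rewrite /= exy.
  by case.
- by move=> x; have := sg (0, x); rewrite /diag2 tr_block_mx => /eq_block_mx[].
- by have [] := unit_diag ug.
- move=> x y; have := mg (0, x) (0, y); rewrite !diag_prod //= /diag2.
  by rewrite add_block_mx scale_block_mx => /eq_block_mx[].
Qed.

(** The Jordan product only yields the symmetrised rule
    F (j+1) = (T F j + F j T^T) / 2, but the two terms are equal because
    every F j is a power of T applied to U. *)
Lemma embeds_jet (A : jordanAlg K) n (f : A -> 'M[K]_n) (e : nat -> A) m :
  embeds f -> e 0%N = jone A -> (forall j, e j.+1 = jmul (e 1%N) (e j)) ->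
  e m = 0 -> jet m (fun j => f (e j)).
Proof.
move=> ef e0 eS em; have [[lf injf] sf uf mf] := ef.
pose V := invmx (f (jone A)); pose X := f (e 1%N).
pose pw j := iter j (mulmx (X *m V)) (f (jone A)).
have pwC j : pw j *m V *m X = X *m V *m pw j.
  elim: j => [|j IH]; first by rewrite /= mulmxV // mul1mx mulmxKV.
  by rewrite /= -!mulmxA; congr (_ *m (_ *m _)); rewrite mulmxA IH mulmxA.
have fpw j : f (e j) = pw j.
  elim: j => [|j IH]; first by rewrite e0.
  rewrite eS mf IH -/X -/V pwC -mulr2n -scaler_nat scalerA mulVf ?scale1r //.
  by rewrite pnatr_eq0.
split; rewrite ?e0 ?em ?embeds0 // => i j; elim: i => [|i IH].
  by rewrite add0n e0 mulmxV // mul1mx.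
by rewrite addSn !fpw /= -!fpw IH !mulmxA.
Qed.

End Embeddings.

(** * Families and spaces of matrices *)

Section Passage.
Variable K : numFieldType.

Definition mxrange T n (f : T -> 'M[K]_n) : set 'M[K]_n :=
  [set f a | a in [set: T]]%classic.

Lemma is_embeddingP (A : jordanAlg K) n (L : set 'M[K]_n) : is_embedding A L ->
  exists f : A -> 'M[K]_n, embeds f /\ L = mxrange f.
Proof.
move=> [U [uU [f [[fM f1] injf ->]]]].
exists (fun a => symval (f a)); split=> //.
have fone : symval (f (jone A)) = U by rewrite f1.
split.
- split=> [a x y|x y /val_inj/injf //].
  by rewrite linearP.
- by move=> x; apply/eqP; exact: symvalP.
- by rewrite fone.
- by move=> x y; rewrite fM fone.
Qed.

Lemma congruent_range T T' m n (f : T -> 'M[K]_m) (g : T' -> 'M[K]_n)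
  (c : T' -> T) : (forall a, exists t, a = c t) ->
  cong (fun t => f (c t)) g -> congruent (mxrange f) (mxrange g).
Proof.
move=> cs [P [Q [PQ fg]]]; have e := esym (inverse_pair_size PQ); subst n.
exists erefl, P; split; first exact: inverse_pair_unit PQ.
apply/seteqP; split=> [_ [t _ <-]|_ [_ [a _ <-] <-]].
  by exists (f (c t)); [exists (c t)|rewrite castmx_id fg].
by have [t ->] := cs a; exists t; rewrite ?castmx_id.
Qed.

Lemma congruent_trans m n p (L : set 'M[K]_m) (L' : set 'M[K]_n)
  (L'' : set 'M[K]_p) : congruent L L' -> congruent L' L'' -> congruent L L''.
Proof.
move=> [e [P [uP ->]]] [e' [P' [uP' ->]]]; subst m; subst p.
exists erefl, (P' *m P); split; first by rewrite unitmx_mul uP' uP.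
apply/seteqP; split=> [_ [_ [X LX <-] <-]|_ [X LX <-]].
  by exists X => //; rewrite !castmx_id trmx_mul !mulmxA.
by exists (P *m castmx (erefl, erefl) X *m P^T);
  [exists X|rewrite !castmx_id trmx_mul !mulmxA].
Qed.

Local Notation K4 := (K * K * K * K)%type.

Lemma family4E n (M : K -> K -> K -> K -> 'M[K]_n) :
  family4 M = mxrange (fun t : K4 => M t.1.1.1 t.1.1.2 t.1.2 t.2).
Proof.
apply/seteqP; split=> [_ [x [y [z [w ->]]]]|_ [[[[x y] z] w] _ <-]].
  by exists (x, y, z, w).
by exists x, y, z, w.
Qed.

(** The surjection c lets the four indeterminates be coordinates of the
    algebra adapted to the normal form. *)
Lemma congruent_family4 T n m (f : T -> 'M[K]_n)
  (M : K -> K -> K -> K -> 'M[K]_m) (c : K4 -> T) :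
  (forall a, exists t, a = c t) ->
  cong (fun t => f (c t)) (fun t => M t.1.1.1 t.1.1.2 t.1.2 t.2) ->
  congruent (mxrange f) (family4 M).
Proof. by rewrite family4E; exact: congruent_range. Qed.

End Passage.

(** * Embeddings of truncated polynomial algebras *)

Section Commutative.
Variable K : numFieldType.
Hypothesis sqrtK : forall x : K, exists y, y ^+ 2 = x.
Local Notation K4 := (K * K * K * K)%type.

Lemma embeds_scalar n (f : comJ K^o -> 'M[K]_n) : embeds f ->
  (0 < n)%N /\ cong f (fun x => (x : K) *: 1%:M : 'M_n).
Proof.
move=> ef; have [[lf injf] sf uf _] := ef; split.
  case: n f ef lf injf {sf uf} => // f ef lf injf.
  have /eqP := oner_neq0 K; case; apply: injf.
  by rewrite [LHS]flatmx0 [RHS]flatmx0.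
have := cong_lin [:: tt] (fun (x : K) _ => x) (cong_one sqrtK (sf 1) uf).
move=> h; apply: cong_trans (cong_trans h _); apply: cong_eq => x;
  rewrite big_seq1 //.
rewrite -(embedsZ _ _ ef); congr f.
by rewrite /= /GRing.scale /= mulr1.
Qed.

Lemma jet1 n (F : nat -> 'M[K]_n) : jet 1 F ->
  cong F (fun j => (j == 0)%N%:R *: 1%:M : 'M_n).
Proof.
move=> jF; have [uF sF _ _] := jF.
have [P [Q [PQ /(_ tt) e]]] := cong_one sqrtK (sF 0%N) uF.
exists P, Q; split=> // -[|j]; first by rewrite scale1r.
by rewrite (jet_ge jF) // mulmx0 mul0mx scale0r.
Qed.

Lemma jet2 n (F : nat -> 'M[K]_n) : jet 2 F -> exists k2 k1,
  cong F (fun j => diag2 ((1%:M : 'M_k2) *t hankel_unit K 2 j)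
                         ((j == 0)%N%:R *: 1%:M : 'M_k1))
  /\ (F 1%N != 0 -> (0 < k2)%N).
Proof.
move=> /(jet_split sqrtK)[k2 [n2 [F2 [c /jet1 c2 k2_gt0]]]].
by exists k2, n2; split=> //; apply: (cong_trans c (cong_diag (cong_refl _) c2)).
Qed.

Lemma jet3 n (F : nat -> 'M[K]_n) : jet 3 F -> exists k3 k2 k1,
  cong F (fun j => diag2 ((1%:M : 'M_k3) *t hankel_unit K 3 j)
                  (diag2 ((1%:M : 'M_k2) *t hankel_unit K 2 j)
                         ((j == 0)%N%:R *: 1%:M : 'M_k1)))
  /\ (F 2%N != 0 -> (0 < k3)%N).
Proof.
move=> /(jet_split sqrtK)[k3 [n2 [F2 [c /jet2[k2 [k1 [c2 _]]] k3_gt0]]]].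
by exists k3, k2, k1; split=> //; apply: (cong_trans c (cong_diag (cong_refl _) c2)).
Qed.

Lemma jet4 n (F : nat -> 'M[K]_n) : jet 4 F -> exists k4 k3 k2 k1,
  cong F (fun j => diag2 ((1%:M : 'M_k4) *t hankel_unit K 4 j)
                  (diag2 ((1%:M : 'M_k3) *t hankel_unit K 3 j)
                  (diag2 ((1%:M : 'M_k2) *t hankel_unit K 2 j)
                         ((j == 0)%N%:R *: 1%:M : 'M_k1))))
  /\ (F 3%N != 0 -> (0 < k4)%N).
Proof.
move=> /(jet_split sqrtK)[k4 [n2 [F2 [c /jet3[k3 [k2 [k1 [c2 _]]]] k4_gt0]]]].
by exists k4, k3, k2, k1; split=> //; apply: (cong_trans c (cong_diag (cong_refl _) c2)).
Qed.

Lemma sum_diag I (r : seq I) (c : I -> K) m n (X : I -> 'M[K]_m) (Y : I -> 'M[K]_n) :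
  \sum_(i <- r) c i *: diag2 (X i) (Y i) =
  diag2 (\sum_(i <- r) c i *: X i) (\sum_(i <- r) c i *: Y i).
Proof.
elim: r => [|i r IH]; first by rewrite !big_nil /diag2 block_mx0.
by rewrite !big_cons IH /diag2 scale_block_mx add_block_mx !(scaler0, addr0).
Qed.

Lemma sum_tens I (r : seq I) (c : I -> K) k m (A : 'M[K]_k) (X : I -> 'M[K]_m) :
  \sum_(i <- r) c i *: (A *t X i) = A *t (\sum_(i <- r) c i *: X i).
Proof.
apply/matrixP => a b; case: (mxtens_indexP a) => a1 a2.
case: (mxtens_indexP b) => b1 b2; rewrite tensmxE !summxE mulr_sumr.
by apply: eq_bigr => i _; rewrite mxE tensmxE mxE mulrCA.
Qed.

Lemma sum_shift2 (c : nat -> K) :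
  \sum_(j <- iota 0 4) c j *: hankel_unit K 2 j = hankel2 (c 0%N) (c 1%N).
Proof.
rewrite !big_cons big_nil; apply/matrixP => -[[|[|i]] hi] [[|[|j]] hj] //;
  rewrite !mxE /= ?(mulr0, mulr1, addr0, add0r) //.
Qed.

Lemma sum_shift3 (c : nat -> K) :
  \sum_(j <- iota 0 4) c j *: hankel_unit K 3 j = hankel3 (c 0%N) (c 1%N) (c 2%N).
Proof.
rewrite !big_cons big_nil; apply/matrixP => -[[|[|[|i]]] hi] [[|[|[|j]]] hj] //;
  rewrite !mxE /= ?(mulr0, mulr1, addr0, add0r) //.
Qed.

Lemma sum_shift4 (c : nat -> K) :
  \sum_(j <- iota 0 4) c j *: hankel_unit K 4 j = hankel4 (c 0%N) (c 1%N) (c 2%N) (c 3%N).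
Proof.
rewrite !big_cons big_nil;
  apply/matrixP => -[[|[|[|[|i]]]] hi] [[|[|[|[|j]]]] hj] //;
  rewrite !mxE /= ?(mulr0, mulr1, addr0, add0r) //.
Qed.

Lemma sum_shift1 (c : nat -> K) k :
  \sum_(j <- iota 0 4) c j *: ((j == 0)%N%:R *: 1%:M) = c 0%N *: 1%:M :> 'M_k.
Proof.
by rewrite !big_cons big_nil /= !scale1r !scale0r !scaler0 !addr0.
Qed.

Definition sum_shift := (sum_diag, sum_tens, sum_shift1, sum_shift2, sum_shift3, sum_shift4).

Section PowerBasis.
Variables (A : jordanAlg K) (e : nat -> A) (c : A -> nat -> K).
Hypothesis e0 : e 0%N = jone A.
Hypothesis eS : forall j, e j.+1 = jmul (e 1%N) (e j).
(* Four terms serve the orders 2, 3 and 4 alike: the powers from e m on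
   vanish. *)
Hypothesis ec : forall a, a = \sum_(j <- iota 0 4) c a j *: e j.
Variables (n : nat) (f : A -> 'M[K]_n).
Hypothesis ef : embeds f.

Lemma power_basis p (G : nat -> 'M[K]_p) : cong (fun j => f (e j)) G ->
  cong f (fun a => \sum_(j <- iota 0 4) c a j *: G j).
Proof.
move=> h; apply: cong_trans (cong_lin (iota 0 4) c h); apply: cong_eq => a.
by rewrite {1}(ec a) (embeds_sum _ _ _ ef).
Qed.

Lemma embeds_neq0 j : e j != 0 -> f (e j) != 0.
Proof.
move=> ej; apply: contraNneq ej => fe; apply/eqP.
have [[_ injf] _ _ _] := ef; apply: injf; rewrite fe.
by rewrite (embeds0 ef).
Qed.

Lemma embeds_powers2 : e 1%N != 0 -> e 2%N = 0 -> exists k2 k1, (0 < k2)%N /\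
  cong f (fun a => diag2 ((1%:M : 'M_k2) *t hankel2 (c a 0%N) (c a 1%N))
                         (c a 0%N *: 1%:M : 'M_k1)).
Proof.
move=> e1 e2; have [k2 [k1 [cF k_gt0]]] := jet2 (embeds_jet ef e0 eS e2).
exists k2, k1; split; first exact: k_gt0 (embeds_neq0 e1).
by apply: (cong_trans (power_basis cF)); apply: cong_eq => a; rewrite !sum_shift.
Qed.

Lemma embeds_powers3 : e 2%N != 0 -> e 3%N = 0 -> exists k3 k2 k1, (0 < k3)%N /\
  cong f (fun a => diag2 ((1%:M : 'M_k3) *t hankel3 (c a 0%N) (c a 1%N) (c a 2%N))
                  (diag2 ((1%:M : 'M_k2) *t hankel2 (c a 0%N) (c a 1%N))
                         (c a 0%N *: 1%:M : 'M_k1))).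
Proof.
move=> e1 e2; have [k3 [k2 [k1 [cF k_gt0]]]] := jet3 (embeds_jet ef e0 eS e2).
exists k3, k2, k1; split; first exact: k_gt0 (embeds_neq0 e1).
by apply: (cong_trans (power_basis cF)); apply: cong_eq => a; rewrite !sum_shift.
Qed.

Lemma embeds_powers4 : e 3%N != 0 -> e 4%N = 0 -> exists k4 k3 k2 k1, (0 < k4)%N /\
  cong f (fun a =>
    diag2 ((1%:M : 'M_k4) *t hankel4 (c a 0%N) (c a 1%N) (c a 2%N) (c a 3%N))
   (diag2 ((1%:M : 'M_k3) *t hankel3 (c a 0%N) (c a 1%N) (c a 2%N))
   (diag2 ((1%:M : 'M_k2) *t hankel2 (c a 0%N) (c a 1%N))
          (c a 0%N *: 1%:M : 'M_k1)))).
Proof.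
move=> e1 e2; have [k4 [k3 [k2 [k1 [cF k_gt0]]]]] := jet4 (embeds_jet ef e0 eS e2).
exists k4, k3, k2, k1; split; first exact: k_gt0 (embeds_neq0 e1).
by apply: (cong_trans (power_basis cF)); apply: cong_eq => a; rewrite !sum_shift.
Qed.

End PowerBasis.

(** The powers of x when x^2 = 0. *)
Definition dual_basis (A : jordanAlg K) (x : A) (j : nat) : A :=
  match j with 0%N => jone A | 1%N => x | _ => 0 end.

Lemma dual_basisS (A : jordanAlg K) (x : A) : jmul x x = 0 ->
  forall j, dual_basis x j.+1 = jmul (dual_basis x 1) (dual_basis x j).
Proof. by move=> xx [|[|j]] /=; rewrite ?jmul0 // jmulC jmul1. Qed.

Lemma embeds_J10 n (f : spinJ K 1 0 -> 'M[K]_n) : embeds f ->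
  exists k2 k1, (0 < k2)%N /\
  cong f (fun a => diag2 ((1%:M : 'M_k2) *t hankel2 a.1 (a.2 0 0))
                         ((a.1 : K) *: 1%:M : 'M_k1)).
Proof.
move=> ef.
pose x : spinJ K 1 0 := (0, 1).
have xx : jmul x x = 0.
  rewrite /= /spin_jmul /= /spin_form big_pred0 // mul0r scale0r !addr0.
  by [].
pose c (a : spinJ K 1 0) j : K :=
  match j with 0%N => a.1 | 1%N => a.2 0 0 | _ => 0 end.
apply: (@embeds_powers2 _ (dual_basis x) c) ef _ _ => //; first exact: dual_basisS.
- move=> [y v]; rewrite !big_cons big_nil /= !scaler0 !addr0.
  congr pair; rewrite /= ?scaler0 ?addr0 ?add0r; first by rewrite /GRing.scale /= mulr1.
  by apply/rowP => i; rewrite !mxE !ord1 mulr1.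
- apply/eqP => -[/rowP/(_ 0)/eqP]; rewrite !mxE; exact/negP/oner_neq0.
Qed.

Section QuotientPolynomials.
Variable m : nat.
Hypotheses (m_gt1 : (1 < m)%N) (m_le4 : (m <= 4)%N).
Local Notation A := (comJ {poly %/ ('X^m : {poly K})}).
Let e j : A := in_qpoly 'X^m 'X^j.
Let c (a : A) j : K := (a : {poly K})`_j.

Lemma mk_monicXm : mk_monic 'X^m = 'X^m :> {poly K}.
Proof. by case: m m_gt1 => // k _; rewrite mk_monic_Xn. Qed.

Lemma qpoly_basis : [/\ e 0%N = jone A, forall j, e j.+1 = jmul (e 1%N) (e j),
  forall a, a = \sum_(j <- iota 0 4) c a j *: e j, e m = 0 & e m.-1 != 0].
Proof.
split.
- by rewrite /e expr0 in_qpoly1.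
- by move=> j; rewrite /e /= exprS in_qpolyM.
- move=> a; have sa : (size (a : {poly K}) <= 4)%N.
    have sm : size (mk_monic 'X^m : {poly K}) = m.+1.
      by rewrite mk_monicXm size_polyXn.
    apply: leq_trans m_le4; rewrite -ltnS -sm; exact: size_mk_monic.
  have eP : \sum_(j <- iota 0 4) c a j *: 'X^j = a :> {poly K}.
    rewrite !big_cons big_nil; apply/polyP => i.
    rewrite !coefD !coefZ !coefXn coef0.
    case: i => [|[|[|[|i]]]];
      rewrite /= ?(mulr0, mulr1, addr0, add0r) // nth_default //.
    exact: leq_trans sa _.
  transitivity (in_qpoly 'X^m (\sum_(j <- iota 0 4) c a j *: 'X^j)).
    rewrite eP; apply: val_inj; exact: (esym (in_qpoly_small (size_mk_monic _))).
  by rewrite !big_cons !big_nil !in_qpolyD !in_qpolyZ in_qpoly0.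
- apply: val_inj; rewrite /= mk_monicXm; apply: Pdiv.RingMonic.rmodpp.
  exact: monicXn.
- apply/eqP => /(congr1 (fun p : {poly %/ 'X^m} => (p : {poly K}))).
  rewrite in_qpoly_small; first by apply/eqP; rewrite -size_poly_gt0 size_polyXn.
  by rewrite mk_monicXm !size_polyXn prednK // ltnW.
Qed.

End QuotientPolynomials.

End Commutative.

(** * Normal forms for the associative algebras *)

Section CommutativeCases.
Variable K : numFieldType.
Hypothesis sqrtK : forall x : K, exists y, y ^+ 2 = x.
Local Notation K4 := (K * K * K * K)%type.
Local Notation KJ := (comJ K^o).

Lemma cong_diagCA I m n p (F : I -> 'M[K]_m) (G : I -> 'M[K]_n)
  (H : I -> 'M[K]_p) :
  cong (fun i => diag2 (F i) (diag2 (G i) (H i)))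
       (fun i => diag2 (G i) (diag2 (F i) (H i))).
Proof.
apply: (cong_trans (cong_diagA _ _ _)).
apply: (cong_trans (cong_diag (cong_diagC _ _) (cong_refl _))).
exact: cong_sym (cong_diagA _ _ _).
Qed.

Definition scalars4 p q r s (x y z w : K) : 'M[K]_(p + (q + (r + s))) :=
  diag2 (x *: 1%:M) (diag2 (y *: 1%:M) (diag2 (z *: 1%:M) (w *: 1%:M))).

Lemma scalars4_swap12 p q r s :
  congruent (family4 (scalars4 p q r s)) (family4 (scalars4 q p r s)).
Proof.
rewrite family4E; apply: (congruent_family4
  (c := fun t : K4 => (t.1.1.2, t.1.1.1, t.1.2, t.2))); last exact: cong_diagCA.
by move=> [[[x y] z] w]; exists (y, x, z, w).
Qed.

Lemma scalars4_swap23 p q r s :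
  congruent (family4 (scalars4 p q r s)) (family4 (scalars4 p r q s)).
Proof.
rewrite family4E; apply: (congruent_family4
  (c := fun t : K4 => (t.1.1.1, t.1.2, t.1.1.2, t.2))).
  by move=> [[[x y] z] w]; exists (x, z, y, w).
exact: cong_diag (cong_refl _) (cong_diagCA _ _ _).
Qed.

Lemma scalars4_swap34 p q r s :
  congruent (family4 (scalars4 p q r s)) (family4 (scalars4 p q s r)).
Proof.
rewrite family4E; apply: (congruent_family4
  (c := fun t : K4 => (t.1.1.1, t.1.1.2, t.2, t.1.2))).
  by move=> [[[x y] z] w]; exists (x, y, w, z).
exact: cong_diag (cong_refl _) (cong_diag (cong_refl _) (cong_diagC _ _)).
Qed.

Lemma congruent_size m n (L : set 'M[K]_m) (L' : set 'M[K]_n) :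
  congruent L L' -> m = n.
Proof. by case. Qed.

(** The multiplicities k_i are the successive differences of the sorted
    block sizes. *)
Lemma scalars4_sorted n (L : set 'M[K]_n) p q r s : (0 < s)%N ->
  (s <= r)%N -> (r <= q)%N -> (q <= p)%N ->
  congruent L (family4 (scalars4 p q r s)) ->
  exists k1 k2 k3 k4 : nat,
    [/\ (1 <= k4)%N, (k1 + 2 * k2 + 3 * k3 + 4 * k4 = n)%N
      & congruent L (A1 K k1 k2 k3 k4)].
Proof.
move=> s0 sr rq qp cL; have en := congruent_size cL.
have [k3 ek3] : exists k3, r = (k3 + s)%N by exists (r - s)%N; rewrite subnK.
have [k2 ek2] : exists k2, q = (k2 + k3 + s)%N.
  by exists (q - r)%N; rewrite -addnA -ek3 subnK.
have [k1 ek1] : exists k1, p = (k1 + k2 + k3 + s)%N.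
  by exists (p - q)%N; rewrite -!addnA (addnA k2) -ek2 subnK.
subst p q r; exists k1, k2, k3, s; split=> //.
by rewrite en; ring.
Qed.

Lemma embedding_K_K_K_K n (L : set 'M[K]_n) :
  is_embedding (prodJ (prodJ (prodJ KJ KJ) KJ) KJ) L ->
  exists k1 k2 k3 k4 : nat,
    [/\ (1 <= k4)%N, (k1 + 2 * k2 + 3 * k3 + 4 * k4 = n)%N
      & congruent L (A1 K k1 k2 k3 k4)].
Proof.
move=> /is_embeddingP[f [ef eL]].
have [p3 [s [f3 [fs [ef3 /(embeds_scalar sqrtK)[s0 cs] cf]]]]] := embeds_prod ef.
have [p2 [r [f2 [fr [ef2 /(embeds_scalar sqrtK)[r0 cr] cf3]]]]] := embeds_prod ef3.
have [p1 [q [f1 [fq [/(embeds_scalar sqrtK)[p0 cp]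
  /(embeds_scalar sqrtK)[q0 cq] cf2]]]]] := embeds_prod ef2.
have : congruent L (family4 (scalars4 p1 q r s)).
  rewrite eL.
  apply: (congruent_family4 (c := fun t : K4 => t : prodJ (prodJ (prodJ KJ KJ) KJ) KJ)).
    by move=> a; exists a.
  apply: (cong_trans cf).
  apply: (cong_trans (cong_diag (cong_comp fst cf3) (cong_comp snd cs))).
  apply: (cong_trans (cong_sym (cong_diagA _ _ _))).
  apply: (cong_trans (cong_diag (cong_comp (fun t => t.1.1) cf2)
           (cong_diag (cong_comp (fun t => t.1.2) cr) (cong_refl _)))).
  apply: (cong_trans (cong_sym (cong_diagA _ _ _))).
  exact: (cong_diag (cong_comp (fun t => t.1.1.1) cp)
    (cong_diag (cong_comp (fun t => t.1.1.2) cq) (cong_refl _))).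
move=> cL; clear - cL p0 q0 r0 s0.
(* Sorting by adjacent exchanges: six comparators sort four sizes. *)
pose G a b c d := congruent L (family4 (scalars4 a b c d)).
have G12 a b c d : G a b c d -> G (maxn a b) (minn a b) c d.
  case: leqP => _ h //; exact: (congruent_trans h (scalars4_swap12 a b c d)).
have G23 a b c d : G a b c d -> G a (maxn b c) (minn b c) d.
  case: leqP => _ h //; exact: (congruent_trans h (scalars4_swap23 a b c d)).
have G34 a b c d : G a b c d -> G a b (maxn c d) (minn c d).
  case: leqP => _ h //; exact: (congruent_trans h (scalars4_swap34 a b c d)).
move: cL; rewrite -/(G _ _ _ _) => /G12/G23/G34/G12/G23/G12 h.
have sorted := scalars4_sorted _ _ _ _ h.
by apply: sorted; lia.
Qed.

Lemma embedding_K_K_J10 n (L : set 'M[K]_n) :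
  is_embedding (prodJ (prodJ KJ KJ) (spinJ K 1 0)) L ->
  exists k1 k2 l1 l2 : nat,
    [/\ (1 <= k2)%N, (1 <= l2)%N, (k1 + 2 * k2 + l1 + 2 * l2 = n)%N
      & congruent L (A2 K k1 k2 l1 l2)].
Proof.
move=> /is_embeddingP[f [ef ->]].
have [p3 [s [f3 [fs [ef3 /(embeds_J10 sqrtK)[l2 [l1 [l2_gt0 cs]]] cf]]]]] :=
  embeds_prod ef.
have [p [q [f1 [f2 [/(embeds_scalar sqrtK)[p0 cp]
  /(embeds_scalar sqrtK)[q0 cq] cf3]]]]] :=
  embeds_prod ef3.
have cff : cong f (fun t => diag2 (t.1.1 *: 1%:M : 'M[K]_p)
    (diag2 (t.1.2 *: 1%:M : 'M[K]_q)
    (diag2 ((1%:M : 'M_l2) *t hankel2 t.2.1 (t.2.2 0 0))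
           ((t.2.1 : K) *: 1%:M : 'M_l1)))).
  apply: (cong_trans cf).
  apply: (cong_trans (cong_diag (cong_comp fst cf3) (cong_comp snd cs))).
  apply: (cong_trans (cong_sym (cong_diagA _ _ _))).
  exact: (cong_diag (cong_comp (fun t => t.1.1) cp)
    (cong_diag (cong_comp (fun t => t.1.2) cq) (cong_refl _))).
(* The larger of the two scalar blocks takes the indeterminate x. *)
suff oriented p' q' (c : K4 -> prodJ (prodJ KJ KJ) (spinJ K 1 0)) :
    (0 < q')%N -> (q' <= p')%N -> (forall a, exists t, a = c t) ->
    cong (fun t => f (c t)) (fun t : K4 => diag2 (t.1.1.1 *: 1%:M : 'M[K]_p')
      (diag2 (t.1.1.2 *: 1%:M : 'M[K]_q')
      (diag2 ((1%:M : 'M_l2) *t hankel2 t.1.2 t.2) (t.1.2 *: 1%:M : 'M_l1)))) ->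
    exists k1 k2 l1 l2 : nat,
    [/\ (1 <= k2)%N, (1 <= l2)%N, (k1 + 2 * k2 + l1 + 2 * l2 = n)%N
      & congruent (mxrange f) (A2 K k1 k2 l1 l2)].
  pose c (t : K4) : prodJ (prodJ KJ KJ) (spinJ K 1 0) :=
    ((t.1.1.1, t.1.1.2), (t.1.2, const_mx t.2)).
  pose c' (t : K4) : prodJ (prodJ KJ KJ) (spinJ K 1 0) :=
    ((t.1.1.2, t.1.1.1), (t.1.2, const_mx t.2)).
  have [qp|/ltnW pq] := leqP q p.
    apply: (oriented p q c) => //.
      move=> [[x y] [z v]]; exists (x, y, z, v 0 0); congr (_, (_, _)).
      by apply/rowP => i; rewrite !mxE ord1.
    apply: (cong_trans (cong_comp c cff)); apply: cong_eq => -[[[x y] z] w].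
    by rewrite /c /= mxE.
  apply: (oriented q p c') => //.
    move=> [[x y] [z v]]; exists (y, x, z, v 0 0); congr (_, (_, _)).
    by apply/rowP => i; rewrite !mxE ord1.
  apply: (cong_trans (cong_comp c' cff)).
  apply: (cong_trans (cong_diagCA _ _ _)); apply: cong_eq => -[[[x y] z] w].
  by rewrite /c' /= mxE.
move=> q'0 qp' cs' cfc; have en := cong_size cfc.
have [k1 ek1] : exists k1, p' = (k1 + q')%N by exists (p' - q')%N; rewrite subnK.
subst p'; exists k1, q', l1, l2; split=> //; first by rewrite en; ring.
exact: (congruent_family4 cs' cfc).
Qed.

Lemma embedding_J10_J10 n (L : set 'M[K]_n) :
  is_embedding (prodJ (spinJ K 1 0) (spinJ K 1 0)) L ->
  exists k1 k2 l1 l2 : nat,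
    [/\ (1 <= k2)%N, (1 <= l2)%N, (k1 + 2 * k2 + l1 + 2 * l2 = n)%N
      & congruent L (A3 K k1 k2 l1 l2)].
Proof.
move=> /is_embeddingP[f [ef ->]].
have [p [q [f1 [f2 [/(embeds_J10 sqrtK)[k2 [k1 [k2_gt0 c1]]]
  /(embeds_J10 sqrtK)[l2 [l1 [l2_gt0 c2]]] cf]]]]] := embeds_prod ef.
have cff := cong_trans (cong_trans cf (cong_diag (cong_comp fst c1) (cong_comp snd c2)))
  (cong_sym (cong_diagA _ _ _)).
exists k1, k2, l1, l2; split=> //; first by rewrite (cong_size cff); ring.
pose c (t : K4) : prodJ (spinJ K 1 0) (spinJ K 1 0) :=
  ((t.1.1.1, const_mx t.1.1.2), (t.1.2, const_mx t.2)).
apply: (congruent_family4 (c := c)).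
  move=> [[x u] [z v]]; exists (x, u 0 0, z, v 0 0).
  by congr ((_, _), (_, _)); apply/rowP => i; rewrite !mxE ord1.
apply: (cong_trans (cong_comp c cff)); apply: cong_eq => -[[[x y] z] w].
by rewrite /c /= !mxE.
Qed.

Lemma A3_swap k1 k2 l1 l2 : congruent (A3 K k1 k2 l1 l2) (A3 K l1 l2 k1 k2).
Proof.
rewrite /A3 family4E; apply: (congruent_family4
  (c := fun t : K4 => (t.1.2, t.2, t.1.1.1, t.1.1.2))) => /=.
  by move=> [[[x y] z] w]; exists (z, w, x, y).
apply: (cong_trans (cong_diagA _ _ _)).
exact: (cong_trans (cong_diagC _ _) (cong_sym (cong_diagA _ _ _))).
Qed.

Lemma qpoly_coef m (s : seq K) j : (1 < m)%N -> (size s <= m)%N ->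
  (in_qpoly 'X^m (Poly s) : {poly K})`_j = s`_j.
Proof.
move=> m1 sm; rewrite in_qpoly_small ?coef_Poly //.
by rewrite mk_monicXm // size_polyXn ltnS (leq_trans (size_Poly s)).
Qed.

Lemma qpoly_coords m (a : {poly %/ ('X^m : {poly K})}) : (1 < m)%N ->
  a = in_qpoly 'X^m (Poly (mkseq (fun j => (a : {poly K})`_j) m)).
Proof.
move=> m1; apply: val_inj; apply/polyP => i.
rewrite -[RHS]/((in_qpoly 'X^m (Poly (mkseq (fun j => (a : {poly K})`_j) m)) : {poly K})`_i).
rewrite qpoly_coef ?size_mkseq //; have [im|mi] := ltnP i m; first by rewrite nth_mkseq.
rewrite [RHS]nth_default ?size_mkseq // nth_default //.
apply: leq_trans mi; have sm : size (mk_monic 'X^m : {poly K}) = m.+1.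
  by rewrite mk_monicXm // size_polyXn.
rewrite -ltnS -sm; exact: size_mk_monic.
Qed.

Lemma embedding_K_trunc3 n (L : set 'M[K]_n) :
  is_embedding (prodJ KJ (comJ {poly %/ ('X^3 : {poly K})})) L ->
  exists r k1 k2 k3 : nat,
    [/\ (1 <= r)%N, (1 <= k3)%N, (r + (k1 + 2 * k2 + 3 * k3) = n)%N
      & congruent L (A4 K r k1 k2 k3)].
Proof.
move=> /is_embeddingP[f [ef ->]].
have [r [m [f1 [f2 [/(embeds_scalar sqrtK)[r0 c1] ef2 cf]]]]] := embeds_prod ef.
have [e0 eS ec e3 e2] := @qpoly_basis K 3 isT isT.
have [k3 [k2 [k1 [k3_gt0 c2]]]] := embeds_powers3 sqrtK e0 eS ec ef2 e2 e3.
have cff := cong_trans cf (cong_diag (cong_comp fst c1) (cong_comp snd c2)).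
exists r, k1, k2, k3; split=> //; first by rewrite (cong_size cff); ring.
pose c (t : K4) : prodJ KJ (comJ {poly %/ ('X^3 : {poly K})}) :=
  (t.2, in_qpoly 'X^3 (Poly [:: t.1.1.1; t.1.1.2; t.1.2])).
have hc t j : ((c t).2 : {poly K})`_j = [:: t.1.1.1; t.1.1.2; t.1.2]`_j.
  exact: qpoly_coef.
apply: (congruent_family4 (c := c)).
  move=> [w a]; exists ((a : {poly K})`_0, (a : {poly K})`_1, (a : {poly K})`_2, w).
  by congr pair; exact: qpoly_coords.
apply: (cong_trans (cong_comp c cff)); apply: cong_eq => -[[[x y] z] w].
by rewrite !hc.
Qed.

Lemma embedding_trunc4 n (L : set 'M[K]_n) :
  is_embedding (comJ {poly %/ ('X^4 : {poly K})}) L ->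
  exists k1 k2 k3 k4 : nat,
    [/\ (1 <= k4)%N, (k1 + 2 * k2 + 3 * k3 + 4 * k4 = n)%N
      & congruent L (A5 K k1 k2 k3 k4)].
Proof.
move=> /is_embeddingP[f [ef ->]].
have [e0 eS ec e4 e3] := @qpoly_basis K 4 isT isT.
have [k4 [k3 [k2 [k1 [k4_gt0 cff]]]]] := embeds_powers4 sqrtK e0 eS ec ef e3 e4.
exists k1, k2, k3, k4; split=> //; first by rewrite (cong_size cff); ring.
pose c (t : K4) : comJ {poly %/ ('X^4 : {poly K})} :=
  in_qpoly 'X^4 (Poly [:: t.1.1.1; t.1.1.2; t.1.2; t.2]).
have hc t j : (c t : {poly K})`_j = [:: t.1.1.1; t.1.1.2; t.1.2; t.2]`_j.
  exact: qpoly_coef.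
apply: (congruent_family4 (c := c)).
  move=> a; exists ((a : {poly K})`_0, (a : {poly K})`_1, (a : {poly K})`_2, (a : {poly K})`_3).
  exact: qpoly_coords.
apply: (cong_trans (cong_comp c cff)); apply: cong_eq => -[[[x y] z] w].
by rewrite !hc.
Qed.

End CommutativeCases.

(** * Spin factors: splitting by the first generators *)

Section Spin.
Variable K : numFieldType.

Lemma two_neq0 : 2 != 0 :> K. Proof. by rewrite pnatr_eq0. Qed.

Lemma mxopp_eq0 m n (X : 'M[K]_(m, n)) : X = - X -> X = 0.
Proof.
move/eqP; rewrite -addr_eq0 -mulr2n -scaler_nat scaler_eq0 (negPf two_neq0).
by move/eqP.
Qed.

(** P1 and P2 span the eigenspaces of X U^-1 for 1 and -1, which are
    orthogonal because the operator is self-adjoint. *)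
Lemma invol_split n (U X : 'M[K]_n) : U^T = U -> U \in unitmx -> X^T = X ->
  X *m invmx U *m X = U ->
  exists p q (P : 'M[K]_(p + q, n)) Q (Up : 'M_p) (Uq : 'M_q),
    [/\ inverse_pair P Q, P *m U *m P^T = diag2 Up Uq
      & P *m X *m P^T = diag2 Up (- Uq)].
Proof.
move=> sU uU sX XX; pose E := 2^-1 *: (1%:M + X *m invmx U).
have EE : E *m E = E.
  rewrite /E -scalemxAl -scalemxAr mulmxDl mul1mx mulmxDr mulmx1 mulmxA XX.
  rewrite mulmxV // [X *m _ + _]addrC -mulr2n -scaler_nat [X in _ *: X]scalerA.
  by rewrite mulVf ?two_neq0 // scale1r.
have [p [q [P1 [P2 [Q [PQ P1E P2E]]]]]] := idem_split EE.
have P1X : P1 *m X = P1 *m U.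
  have := congr1 ( *:%R 2) P1E; rewrite /E -scalemxAr scalerA mulfV ?two_neq0 //.
  rewrite scale1r mulmxDr mulmx1 scaler_nat mulr2n => /addrI.
  by rewrite mulmxA => /(congr1 (mulmx^~ U)); rewrite mulmxKV.
have P2X : P2 *m X = - (P2 *m U).
  have := congr1 ( *:%R 2) P2E; rewrite /E -scalemxAr scalerA mulfV ?two_neq0 //.
  rewrite scale1r scaler0 mulmxDr mulmx1 mulmxA => /eqP.
  rewrite addrC addr_eq0 => /eqP/(congr1 (mulmx^~ U)).
  by rewrite mulmxKV // mulNmx.
have XP2 : X *m P2^T = - (U *m P2^T).
  by rewrite -[LHS]trmxK trmx_mul trmxK sX P2X linearN /= trmx_mul sU.
have o12 : P1 *m U *m P2^T = 0.
  by apply: mxopp_eq0; rewrite -{1}P1X -!mulmxA XP2 mulmxN.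
have o21 : P2 *m U *m P1^T = 0.
  by apply: trmx_inj; rewrite trmx0 !trmx_mul trmxK sU mulmxA o12.
exists p, q, (col_mx P1 P2), Q, (P1 *m U *m P1^T), (P2 *m U *m P2^T).
split=> //; rewrite col_congr /diag2; first by rewrite o12 o21.
by rewrite P1X P2X !mulNmx o12 o21 oppr0.
Qed.

(** An operator that anticommutes with an involution exchanges its
    eigenspaces, so its diagonal blocks vanish. *)
Lemma anticomm_block p q (Up : 'M[K]_p) (Uq : 'M_q) (Y : 'M_(p + q)) :
  diag2 Up Uq \in unitmx -> Y^T = Y ->
  diag2 Up (- Uq) *m invmx (diag2 Up Uq) *m Y
    + Y *m invmx (diag2 Up Uq) *m diag2 Up (- Uq) = 0 ->
  exists B, Y = block_mx 0 B B^T 0.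
Proof.
move=> uD; have [uUp uUq] := unit_diag uD; rewrite -[Y]submxK.
move: (ulsubmx Y) (ursubmx Y) (dlsubmx Y) (drsubmx Y) => a b c d.
rewrite tr_block_mx => /eq_block_mx[_ cb _ _].
rewrite /diag2 (invmx_block_diag uD) !mulmx_block.
rewrite !(mulmx0, mul0mx, addr0, add0r) !mulNmx !mulmxV //.
rewrite -!mulmxA !mulmxN !mulVmx // ?(mulmxN, mulNmx) !(mul1mx, mulmx1).
rewrite add_block_mx -[X in _ = X]block_mx0 => /eq_block_mx[a0 _ _ d0].
exists b; congr block_mx; last 1 first.
- by apply: mxopp_eq0; apply/eqP; rewrite -addr_eq0 -oppr_eq0 opprD d0.
- by apply: mxopp_eq0; apply/eqP; rewrite -addr_eq0 a0.
- by rewrite -cb trmxK.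
Qed.

Lemma antidiag_prod p q (Up : 'M[K]_p) (Uq : 'M_q) (B C : 'M_(p, q)) :
  diag2 Up Uq \in unitmx ->
  block_mx 0 B B^T 0 *m invmx (diag2 Up Uq) *m block_mx 0 C C^T 0 =
  diag2 (B *m invmx Uq *m C^T) (B^T *m invmx Up *m C).
Proof.
move=> uD; rewrite /diag2 (invmx_block_diag uD) !mulmx_block.
by rewrite !(mulmx0, mul0mx, addr0, add0r).
Qed.

Section SpinSplit.
Variables (d r n : nat) (f : spinJ K d r -> 'M[K]_n).
Hypothesis ef : embeds f.
Let U := f (jone _).
Let X (i : 'I_d) : 'M[K]_n := f (0, delta_mx 0 i).
Let beta (i j : 'I_d) : K := ((i == j) && (i < r)%N)%:R.

Lemma spin_coord (a : spinJ K d r) : f a = (a.1 : K) *: U + \sum_i a.2 0 i *: X i.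
Proof.
have [[lf _] _ _ _] := ef.
case: a => x v /=; have -> : (x, v) = x *: jone (spinJ K d r) + (0, v).
  by congr pair; rewrite /= ?scaler0 ?add0r // addr0 /GRing.scale /= mulr1.
rewrite lf; congr (_ + _); rewrite [in LHS](row_sum_delta v).
elim/big_rec2: _ => [|i Y u _ <-]; first exact: (embeds0 ef).
rewrite -lf; congr f; congr pair => /=.
by rewrite scaler0 addr0.
Qed.

(** The polarised form of the relation v^2 = beta(v, v) 1. *)
Lemma spin_rel i j : X i *m invmx U *m X j + X j *m invmx U *m X i =
  (2 * beta i j) *: U.
Proof.
have [[lf _] _ _ mf] := ef.
have := mf ((0, delta_mx 0 i) : spinJ K d r) (0, delta_mx 0 j); rewrite -/U -/(X i) -/(X j).
have -> : @jmul K (spinJ K d r) (0, delta_mx 0 i) (0, delta_mx 0 j) =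
    beta i j *: jone (spinJ K d r).
  rewrite /= /spin_jmul /= mul0r add0r !scale0r addr0; congr pair.
    rewrite /GRing.scale /= mulr1 /spin_form /beta.
    have [ir|ir] := boolP (i < r)%N; last first.
      rewrite andbF big1 // => k kr; rewrite !mxE eqxx /=.
      have [ki|ki] := eqVneq k i; last by rewrite mul0r.
      by rewrite -ki kr in ir.
    rewrite (bigD1 i) //= !mxE !eqxx mul1r big1 ?addr0 ?andbT //.
    by move=> k /andP[_ /negPf ki]; rewrite !mxE ki andbF mul0r.
  by rewrite scaler0.
rewrite (embedsZ _ _ ef) -scalerA => ->.
by rewrite scalerA mulfV ?two_neq0 // scale1r.
Qed.

End SpinSplit.

(** The first generator is an involution and the other generators
    anticommute with it; B i is the block, between the two eigenspaces, of the
    generator with index lift ord0 i, and the relations are the Clifford relations block by block. *)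
Lemma spin_split d r n (f : spinJ K d.+1 r.+1 -> 'M[K]_n) : embeds f ->
  exists p q (Up : 'M_p) (Uq : 'M_q) (B : 'I_d -> 'M_(p, q)),
  [/\ [/\ Up^T = Up, Uq^T = Uq, Up \in unitmx & Uq \in unitmx],
      forall i j, B i *m invmx Uq *m (B j)^T + B j *m invmx Uq *m (B i)^T =
        (2 * ((i == j) && (i < r)%N)%:R) *: Up,
      forall i j, (B i)^T *m invmx Up *m B j + (B j)^T *m invmx Up *m B i =
        (2 * ((i == j) && (i < r)%N)%:R) *: Uq
    & cong f (fun a => block_mx ((a.1 + a.2 0 0) *: Up)
        (\sum_i a.2 0 (lift ord0 i) *: B i)
        (\sum_i a.2 0 (lift ord0 i) *: (B i)^T)
        ((a.1 - a.2 0 0) *: Uq))].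
Proof.
move=> ef; have [[lf injf] sf uf _] := ef.
set U := f (jone _) in uf.
pose X (i : 'I_d.+1) : 'M[K]_n := f (0, delta_mx 0 i).
have sU : U^T = U by exact: sf.
have sX i : (X i)^T = X i by exact: sf.
have rel i j : X i *m invmx U *m X j + X j *m invmx U *m X i =
  (2 * ((i == j) && (i < r.+1)%N)%:R) *: U by exact: spin_rel.
have XX : X ord0 *m invmx U *m X ord0 = U.
  have := rel ord0 ord0; rewrite eqxx /= mulr1 -mulr2n -scaler_nat.
  by move/(congr1 ( *:%R 2^-1)); rewrite !scalerA mulVf ?two_neq0 // !scale1r.
have [p [q [P [Q [Up [Uq [PQ eU eX]]]]]]] := invol_split sU uf (sX ord0) XX.
have uD : diag2 Up Uq \in unitmx by rewrite -eU; have [] := congr_unit PQ uf.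
have [uUp uUq] := unit_diag uD.
have [sUp sUq] : Up^T = Up /\ Uq^T = Uq.
  have : (diag2 Up Uq)^T = diag2 Up Uq by rewrite -eU congr_sym.
  by rewrite /diag2 tr_block_mx => /eq_block_mx[].
have relP i j : (P *m X i *m P^T) *m invmx (diag2 Up Uq) *m (P *m X j *m P^T)
   + (P *m X j *m P^T) *m invmx (diag2 Up Uq) *m (P *m X i *m P^T) =
   (2 * ((i == j) && (i < r.+1)%N)%:R) *: diag2 Up Uq.
  rewrite -eU !(congr_prod _ _ PQ uf) -mulmxDl -mulmxDr rel.
  by rewrite -scalemxAr -scalemxAl.
have exB (i : 'I_d) : exists B, P *m X (lift ord0 i) *m P^T == block_mx 0 B B^T 0.
  have [||B ->] := @anticomm_block _ _ Up Uq (P *m X (lift ord0 i) *m P^T) uD.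
  - by rewrite congr_sym.
  - by rewrite -eX relP (negPf (neq_lift _ _)) mulr0 scale0r.
  by exists B.
have [B eB] : exists B : 'I_d -> 'M_(p, q),
    forall i, P *m X (lift ord0 i) *m P^T = block_mx 0 (B i) (B i)^T 0.
  by exists (fun i => xchoose (exB i)) => i; apply/eqP; exact: (xchooseP (exB i)).
have relB i j := relP (lift ord0 i) (lift ord0 j).
exists p, q, Up, Uq, B; split=> //.
- move=> i j; move: (relB i j); rewrite !eB !antidiag_prod // /diag2.
  by rewrite add_block_mx scale_block_mx => /eq_block_mx[-> _ _ _];
    rewrite (inj_eq lift_inj).
- move=> i j; move: (relB i j); rewrite !eB !antidiag_prod // /diag2.
  by rewrite add_block_mx scale_block_mx => /eq_block_mx[_ _ _ ->];
    rewrite (inj_eq lift_inj).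
exists P, Q; split=> // a; rewrite (spin_coord ef) -/U big_ord_recl.
rewrite mulmxDr mulmxDl -scalemxAr -scalemxAl eU mulmxDr mulmxDl.
rewrite -scalemxAr -scalemxAl -/(X ord0) eX mulmx_sumr mulmx_suml.
under [X in _ = _ + (_ + X)]eq_bigr => i _ do
  rewrite -scalemxAr -scalemxAl -/(X (lift ord0 i)) eB.
have -> : \sum_i a.2 0 (lift ord0 i) *: block_mx 0 (B i) (B i)^T 0 =
  block_mx 0 (\sum_i a.2 0 (lift ord0 i) *: B i)
             (\sum_i a.2 0 (lift ord0 i) *: (B i)^T) 0.
  elim/big_rec3: _ => [|i x y z _ ->]; first by rewrite block_mx0.
  by rewrite scale_block_mx add_block_mx !(scaler0, addr0).
rewrite /diag2 !scale_block_mx !add_block_mx !(scaler0, addr0, add0r).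
by rewrite scalerDl scalerBl scalerN.
Qed.

(** The relations of B_0 with itself say that Q = B_0 Uq^-1 is an isometry
    from one eigenspace to the other, so Q carries Uq to Up = W and B_0 to W.
    The relation of B_i with B_0 makes the transported block C_i
    alternating, and the square of the corresponding generator becomes
    minus the square of C_i W^-1. *)
Lemma spin_double d r n (f : spinJ K d.+2 r.+2 -> 'M[K]_n) : embeds f ->
  exists p (W : 'M_p) (C : 'I_d -> 'M_p),
  [/\ W^T = W, W \in unitmx, forall i, (C i)^T = - C i,
      forall i, C i *m invmx W *m C i = - (i < r)%N%:R *: W
    & cong f (fun a => block_mx ((a.1 + a.2 0 0) *: W)
        (a.2 0 (lift ord0 ord0) *: W
           + \sum_i a.2 0 (lift ord0 (lift ord0 i)) *: C i)
        (a.2 0 (lift ord0 ord0) *: W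
           - \sum_i a.2 0 (lift ord0 (lift ord0 i)) *: C i)
        ((a.1 - a.2 0 0) *: W))].
Proof.
move=> /spin_split[p [q [Up [Uq [B [[sUp sUq uUp uUq] rp rq cf]]]]]].
have half m (X Y : 'M[K]_m) : X + X = (2 * 1) *: Y -> X = Y.
  rewrite mulr1 -mulr2n -scaler_nat => /(congr1 ( *:%R 2^-1)).
  by rewrite !scalerA mulVf ?two_neq0 // !scale1r.
have B0p : B ord0 *m invmx Uq *m (B ord0)^T = Up by apply: half; rewrite rp eqxx.
have B0q : (B ord0)^T *m invmx Up *m B ord0 = Uq by apply: half; rewrite rq eqxx.
pose Q := B ord0 *m invmx Uq; pose Q' := (B ord0)^T *m invmx Up.
have VqT : (invmx Uq)^T = invmx Uq by rewrite trmx_inv sUq.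
have QT : Q^T = invmx Uq *m (B ord0)^T by rewrite trmx_mul VqT.
have QQ' : inverse_pair Q Q'.
  by split; rewrite /Q /Q' mulmxA ?B0p ?B0q mulmxV.
pose C i := B (lift ord0 i) *m invmx Uq *m (B ord0)^T.
have CT i : (C i)^T = - C i.
  apply/eqP; rewrite -addr_eq0 /C !trmx_mul trmxK VqT mulmxA.
  by rewrite rp (negPf (neq_lift _ _)) mulr0 scale0r.
exists p, Up, C; split=> //.
- move=> i; rewrite /C.
  have := rq ord0 (lift ord0 i); rewrite /= mulr0 scale0r => /eqP.
  rewrite addr_eq0 => /eqP anti.
  rewrite -!mulmxA (mulmxA (B ord0)^T) (mulmxA ((B ord0)^T *m _)) anti.
  rewrite !mulNmx !mulmxN !mulmxA.
  have -> : B (lift ord0 i) *m invmx Uq *m (B (lift ord0 i))^T = (i < r)%N%:R *: Up.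
    apply: half; rewrite rp eqxx /= scalerA mulr1; congr (_ *: _).
  rewrite -!scalemxAl mulmxV // mul1mx scaleNr; congr (- (_ *: _)).
  exact: B0p.
apply: (cong_trans cf).
exists (block_mx 1%:M 0 0 Q), (block_mx 1%:M 0 0 Q'); split.
  exact: inverse_pair_diag (invpair1 _ _) QQ'.
move=> a; rewrite tr_block_mx !mulmx_block.
rewrite !(trmx0, trmx1, mulmx0, mul0mx, addr0, add0r, mulmx1, mul1mx).
rewrite !big_ord_recl !mulmxDl !mulmxDr !mulmx_sumr !mulmx_suml.
congr block_mx.
- rewrite -scalemxAl QT mulmxA B0p; congr (_ + _).
  by apply: eq_bigr => i _; rewrite -scalemxAl mulmxA.
- rewrite -scalemxAr B0p; congr (_ + _); rewrite -sumrN.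
  apply: eq_bigr => i _; rewrite -scalemxAr -scalerN -CT /C; congr (_ *: _).
  by rewrite !trmx_mul trmxK VqT mulmxA.
by rewrite -scalemxAr -scalemxAl QT /Q mulmxKV // mulmxA B0p.
Qed.

End Spin.

(** * Alternating forms on a symmetric space *)

Section SkewPairs.
Variable K : numFieldType.
Hypothesis sqrtK : forall x : K, exists y, y ^+ 2 = x.

Definition mxpair n (W C : 'M[K]_n) (b : bool) : 'M[K]_n := if b then W else C.

(** A symmetric form W with an alternating form C for which the operator
    C W^-1 squares to eps: eps = -1 when the third generator of a spin factor
    squares to 1, and eps = 0 when it squares to 0. *)
Definition skew_pair n (eps : K) (W C : 'M[K]_n) : Prop :=
  [/\ W^T = W, W \in unitmx, C^T = - C & C *m invmx W *m C = eps *: W].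

Lemma skew_pair_cong m n eps (W C : 'M[K]_m) (W' C' : 'M_n) :
  cong (mxpair W C) (mxpair W' C') -> skew_pair eps W C -> skew_pair eps W' C'.
Proof.
move=> [P [Q [PQ e]]] [sW uW sC CC].
have eW : W' = P *m W *m P^T by exact: (e true).
have eC : C' = P *m C *m P^T by exact: (e false).
split.
- by rewrite eW congr_sym.
- by rewrite eW; have [] := congr_unit PQ uW.
- by rewrite eC !trmx_mul sC trmxK !mulNmx !mulmxN mulmxA.
- by rewrite eW eC (congr_prod _ _ PQ uW) CC -scalemxAr -scalemxAl.
Qed.

Lemma skew_pair_diag m n eps (W C : 'M[K]_m) (W' C' : 'M_n) :
  skew_pair eps (diag2 W W') (diag2 C C') -> skew_pair eps W' C'.
Proof.
move=> [sW uW sC CC]; split.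
- by move: sW; rewrite /diag2 tr_block_mx => /eq_block_mx[].
- by have [] := unit_diag uW.
- by move: sC; rewrite /diag2 tr_block_mx opp_block_mx => /eq_block_mx[].
- by move: CC; rewrite diag_prod // /diag2 scale_block_mx => /eq_block_mx[].
Qed.

Lemma mxpair_diag m n (W C : 'M[K]_m) (W' C' : 'M_n) :
  cong (fun b => diag2 (mxpair W C b) (mxpair W' C' b))
       (mxpair (diag2 W W') (diag2 C C')).
Proof. by apply: cong_eq => -[]. Qed.

Lemma skew_form n (C : 'M[K]_n) (u : 'rV_n) : C^T = - C -> u *m C *m u^T = 0.
Proof.
move=> sC; apply: mxopp_eq0.
have tr1 (x : 'M[K]_1) : x^T = x by rewrite [x]mx11_scalar tr_scalar_mx.
by rewrite -[LHS]tr1 !trmx_mul trmxK sC mulNmx mulmxN mulmxA.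
Qed.

(** C is alternating, so C W^-1 is anti-self-adjoint and stability under it
    implies stability under its adjoint. *)
Lemma skew_pair_split d n eps (W C : 'M[K]_n) (P1 : 'M_(d, n)) :
  skew_pair eps W C -> P1 *m W *m P1^T \in unitmx ->
  (exists M, P1 *m C = M *m P1 *m W) ->
  exists n2 (W2 C2 : 'M_n2), skew_pair eps W2 C2 /\
    cong (mxpair W C) (mxpair (diag2 (P1 *m W *m P1^T) W2)
                              (diag2 (P1 *m C *m P1^T) C2)).
Proof.
move=> sp uG [M eM]; have [sW uW sC CC] := sp.
have [b|b|n2 [F2 cF]] := @cong_split K bool _ _ (mxpair W C) W P1 sW uG.
- by case: b; [exists 1%:M; rewrite mul1mx | exists M].
- case: b; first by exists 1%:M; rewrite /= sW mul1mx.
  by exists (- M); rewrite /= sC mulmxN eM !mulNmx.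
exists n2, (F2 true), (F2 false).
have c : cong (mxpair W C) (mxpair (diag2 (P1 *m W *m P1^T) (F2 true))
                              (diag2 (P1 *m C *m P1^T) (F2 false))).
  by apply: (cong_trans cF); apply: cong_eq => -[].
by split=> //; exact: skew_pair_diag (skew_pair_cong c sp).
Qed.

Lemma skew2_block : skew2 K = block_mx (0 : 'M_1) 1%:M (- 1%:M) 0 :> 'M_(1 + 1).
Proof.
apply/matrixP => -[[|[|i]] hi] [[|[|j]] hj] //; rewrite [RHS]mxE;
  (case: splitP => -[[|k] hk] //= ek); rewrite !mxE;
  (case: splitP => -[[|l] hl] //= el); rewrite ?mxE //=.
Qed.

(** For u W u^T = 1 and S = C W^-1, the vectors u and uS are orthonormal,
    since S is anti-self-adjoint and S^2 = -1, and they span an S-stable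
    plane on which C is skew2. *)
Lemma skew_involution n (W C : 'M[K]_n) : skew_pair (-1) W C ->
  exists q, cong (mxpair W C)
    (mxpair 1%:M ((1%:M : 'M_q) *t skew2 K)).
Proof.
elim/ltn_ind: n W C => n IH W C sp; have [sW uW sC CC] := sp.
have [n0|n_gt0] := posnP n.
  subst n; exists 0%N; apply: cong_eq => b.
  by rewrite [LHS]flatmx0 [RHS]flatmx0.
have W0 : W != 0.
  apply: contraL uW => /eqP->; rewrite unitmxE.
  by case: n n_gt0 {IH W C sp sW sC CC} => // n _; rewrite det0 unitr0.
have [u uWu] := exists_unit_vector sqrtK sW W0.
pose P1 := col_mx u (u *m C *m invmx W).
have VT : (invmx W)^T = invmx W by rewrite trmx_inv sW.
have uSC : u *m C *m invmx W *m C = - (u *m W).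
  by rewrite -!mulmxA (mulmxA C) CC scaleN1r mulmxN.
have Su : (u *m C *m invmx W)^T = - (invmx W *m C *m u^T).
  by rewrite !trmx_mul VT sC !mulNmx mulmxN mulmxA.
have uCu := skew_form u sC.
have SWS : u *m C *m invmx W *m W = u *m C by rewrite mulmxKV.
have g1 : u *m C *m (u *m C *m invmx W)^T = 1%:M.
  by rewrite Su mulmxN !mulmxA uSC mulNmx opprK.
have g0 : u *m W *m (u *m C *m invmx W)^T = 0.
  by rewrite Su mulmxN !mulmxA mulmxK // uCu oppr0.
have GW : P1 *m W *m P1^T = 1%:M.
  by rewrite /P1 col_congr SWS uWu g0 uCu g1 -scalar_mx_block.
have GC : P1 *m C *m P1^T = skew2 K.
  by rewrite /P1 col_congr skew2_block uSC !mulNmx uCu g1 uWu g0 oppr0.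
have [||n2 [W2 [C2 [sp2 cF]]]] := skew_pair_split (P1 := P1) sp.
- by rewrite GW unitmx1.
- exists (block_mx 0 1%:M (- 1%:M) 0).
  rewrite /P1 mul_col_mx mul_block_col !mul0mx mulNmx !mul1mx addr0 add0r.
  by rewrite mul_col_mx uSC SWS mulNmx.
have en := cong_size cF; subst n.
have [|q cq] := IH n2 _ _ _ sp2; first by rewrite addnC addn2 ltnS leqnSn.
exists q.+1; apply: (cong_trans cF); rewrite GW GC.
apply: (cong_trans (cong_sym (mxpair_diag _ _ _ _))).
apply: (cong_trans (cong_diag (cong_refl _) cq)).
apply: (cong_trans (mxpair_diag _ _ _ _)).
apply: cong_eq => -[] /=; last by rewrite tens1S.
by rewrite /diag2 -scalar_mx_block.
Qed.

End SkewPairs.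

(** * Alternating forms of square zero *)

Section Nested.
Variable K : numFieldType.
Hypothesis sqrtK : forall x : K, exists y, y ^+ 2 = x.

Lemma block_natE m m' n n' (f g : nat -> nat -> K)
    (i : 'I_(m + n)) (j : 'I_(m' + n')) :
  block_mx (\matrix_(i < m, j < m') f i j) 0 0 (\matrix_(i < n, j < n') g i j) i j =
  if (i < m)%N then (if (j < m')%N then f i j else 0)
  else (if (j < m')%N then 0 else g (i - m)%N (j - m')%N).
Proof.
case: (split_ordP i) => a ->; case: (split_ordP j) => b ->;
  rewrite ?(block_mxEul, block_mxEur, block_mxEdl, block_mxEdr) !mxE //=.
by rewrite !addKn.
Qed.

(** The matrix Diag(1_k (x) skew2, 0) written with natural number indices,
    a form in which relabelling reduces to arithmetic. *)
Definition skew_diagmx m k : 'M[K]_m := \matrix_(i, j)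
  ([&& ~~ odd i, (j == i.+1 :> nat) & (i < 2 * k)%N]%:R
   - [&& ~~ odd j, (i == j.+1 :> nat) & (j < 2 * k)%N]%:R).

Lemma skew_diagmx0 m : skew_diagmx m 0 = 0.
Proof. by apply/matrixP => i j; rewrite !mxE !ltn0 !andbF subrr. Qed.

Lemma skew_diagmx_diag k r : skew_diagmx (k * 2 + r) k = diag2 ((1%:M : 'M_k) *t skew2 K) 0.
Proof.
apply/matrixP => i j; rewrite /diag2 mxE.
have b0 (b c : bool) : b = false -> c = false -> 0 = b%:R - c%:R :> K.
  by move=> -> ->; rewrite subrr.
case: (split_ordP i) => x ->; case: (split_ordP j) => y ->;
  rewrite ?(block_mxEul, block_mxEur, block_mxEdl, block_mxEdr) /=;
  try by rewrite [RHS]mxE; apply/esym/b0; have := ltn_ord x; have := ltn_ord y; lia.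
case: (mxtens_indexP x) => a c; case: (mxtens_indexP y) => b d.
rewrite tensmxE !mxE /=; case: c => [[|[|c]] hc] //; case: d => [[|[|d]] hd] //=.
- by rewrite mulr0; apply/esym/b0; lia.
- rewrite mulr1 -[RHS]subr0; congr (_%:R - _); last first.
    by rewrite (_ : [&& _, _ & _] = false) //; lia.
  by congr nat_of_bool; rewrite -val_eqE /=; have := ltn_ord a; lia.
- rewrite mulrN mulr1 -[RHS]add0r; congr (_ - _%:R).
    by rewrite (_ : [&& _, _ & _] = false) //; lia.
  by congr nat_of_bool; rewrite -val_eqE /=; have := ltn_ord b; lia.
- by rewrite mulr0; apply/esym/b0; lia.
Qed.

(** Where the indices of a direct sum go when its first block, of size
    c + d, is wrapped around the second one, of size m: the first c indices
    stay in front and the next d move behind.  This is how J_(c+c+m) contains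
    J_(c+c) and J_m. *)
Definition nest_nat c d m i : nat :=
  if (i < c)%N then i else if (i < c + d)%N then (i + m)%N else (i - d)%N.

Lemma nest_ltn c d m (i : 'I_(c + d + m)) : (nest_nat c d m i < c + d + m)%N.
Proof.
rewrite /nest_nat; have := ltn_ord i.
by case: (ltnP i c); case: (ltnP i (c + d)); lia.
Qed.

Definition nest c d m (i : 'I_(c + d + m)) : 'I_(c + d + m) := Ordinal (nest_ltn i).

Lemma nest_inj c d m : injective (@nest c d m).
Proof.
move=> i j []; rewrite /nest_nat => e; apply: val_inj => /=; move: e.
have := ltn_ord i; have := ltn_ord j.
case: (ltnP i c); case: (ltnP i (c + d)); case: (ltnP j c);
  case: (ltnP j (c + d)); lia.
Qed.

Lemma antidiag_nest c m (i j : 'I_(c + c + m)) :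
  antidiag K (c + c + m) (nest i) (nest j) =
  diag2 (antidiag K (c + c)) (antidiag K m) i j.
Proof.
rewrite /diag2 /antidiag (block_natE (fun i j => ((i + j).+1 == _)%:R)
  (fun i j => ((i + j).+1 == _)%:R)) mxE /= /nest_nat.
have b0 (b : bool) : b = false -> b%:R = 0 :> K by move->.
have := ltn_ord i; have := ltn_ord j.
case: (ltnP i c); case: (ltnP i (c + c)); case: (ltnP j c); case: (ltnP j (c + c));
  move=> *; solve [congr (nat_of_bool _)%:R; lia | apply: b0; lia].
Qed.

Lemma skew_diagmx_nest m k (i j : 'I_(2 + 2 + m)) : (2 * k <= m)%N ->
  skew_diagmx (2 + 2 + m) k.+1 (nest i) (nest j) =
  diag2 (skew_diagmx (2 + 2) 1) (skew_diagmx m k) i j.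
Proof.
move=> km.
rewrite /diag2 /skew_diagmx (block_natE 
 (fun i j => [&& ~~ odd i, j == i.+1 & (i < 2 * 1)%N]%:R
   - [&& ~~ odd j, i == j.+1 & (j < 2 * 1)%N]%:R)
 (fun i j => [&& ~~ odd i, j == i.+1 & (i < 2 * k)%N]%:R
   - [&& ~~ odd j, i == j.+1 & (j < 2 * k)%N]%:R)) mxE /= /nest_nat.
have b0 (b c : bool) : b = false -> c = false -> b%:R - c%:R = 0 :> K.
  by move=> -> ->; rewrite subrr.
have := ltn_ord i; have := ltn_ord j.
case: (ltnP i 2); case: (ltnP i (2 + 2)); case: (ltnP j 2); case: (ltnP j (2 + 2));
  move=> *; solve [congr ((nat_of_bool _)%:R - (nat_of_bool _)%:R); lia | apply: b0; lia].
Qed.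

Lemma exists_pairing m n (B : 'M[K]_(m, n)) : B != 0 ->
  exists (u : 'rV_m) (v : 'rV_n), u *m B *m v^T = 1%:M.
Proof.
move=> /neq0_entry[i [j Bij]].
exists ((B i j)^-1 *: delta_mx 0 i), (delta_mx 0 j).
rewrite -!scalemxAl -rowE trmx_delta -colE [col _ _]mx11_scalar !mxE.
by rewrite scale_scalar_mx mulVf.
Qed.

Lemma antidiag_block c :
  block_mx 0 (antidiag K c) (antidiag K c) 0 = antidiag K (c + c).
Proof.
have b0 (b : bool) : b = false -> 0 = b%:R :> K by move->.
apply/matrixP => i j; rewrite [RHS]mxE.
case: (split_ordP i) => a ->; case: (split_ordP j) => b ->;
  rewrite ?(block_mxEul, block_mxEur, block_mxEdl, block_mxEdr) mxE /=;
  have := ltn_ord a; have := ltn_ord b; move=> *;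
  solve [congr (nat_of_bool _)%:R; lia | apply: b0; lia].
Qed.

Lemma skew_diagmx_block : block_mx (skew2 K) 0 0 0 = skew_diagmx (2 + 2) 1.
Proof.
apply/matrixP => i j; rewrite [RHS]mxE.
case: (split_ordP i) => a ->; case: (split_ordP j) => b ->;
  rewrite ?(block_mxEul, block_mxEur, block_mxEdl, block_mxEdr) mxE;
  case: a => [[|[|a]] ha] //; case: b => [[|[|b]] hb] //;
  solve [exact: esym (subrr 0) | exact: esym (subr0 1) | exact: esym (sub0r 1)].
Qed.

(** Let S = C W^-1, so S^2 = 0.  For u, v with u C v^T = 1 the vectors uS
    and vS are isotropic and orthogonal, and they pair with v and u.  Adding
    combinations of them to u and v makes these isotropic and orthogonal as
    well.  Then u, v, uS, -vS have Gram matrix J_4 and C lives on u, v only,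
    as skew2.  Each step uses 4 dimensions, whence 4 k <= n. *)
Lemma skew_nilpotent n (W C : 'M[K]_n) : skew_pair 0 W C ->
  exists k, [/\ (4 * k <= n)%N, C != 0 -> (0 < k)%N &
    cong (mxpair W C) (mxpair (antidiag K n) (skew_diagmx n k))].
Proof.
elim/ltn_ind: n W C => n IH W C sp; have [sW uW sC CC] := sp.
have [C0|C0] := eqVneq C 0.
  exists 0%N; split=> //.
  have [P [Q [PQ /(_ tt) e]]] :=
    cong_sym_unit sqrtK sW uW (tr_antidiag K n) (antidiag_unit K n).
  exists P, Q; split=> // -[] //=.
  by rewrite skew_diagmx0 C0 mulmx0 mul0mx.
have [u [v uCv]] := exists_pairing C0.
pose Z0 := col_mx u v; pose V := invmx W.
have VT : V^T = V by rewrite trmx_inv sW.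
have CVC : C *m V *m C = 0 by rewrite CC scale0r.
have J2 : skew2 K *m skew2 K = - 1%:M.
  apply/matrixP => -[[|[|i]] hi] [[|[|j]] hj] //;
    by rewrite !mxE !big_ord_recl big_ord0 !mxE /=; ring.
have JT : (skew2 K)^T = - skew2 K.
  by apply/matrixP => -[[|[|i]] hi] [[|[|j]] hj] //; rewrite !mxE /=; ring.
have Z0C : Z0 *m C *m Z0^T = skew2 K.
  rewrite col_congr !skew_form // uCv skew2_block; congr block_mx.
  apply: trmx_inj; rewrite !trmx_mul trmxK sC mulNmx mulmxN mulmxA uCv.
  by rewrite linearN /= trmx1.
pose G := Z0 *m W *m Z0^T.
have GT : G^T = G by rewrite /G congr_sym.
(* Replacing Z0 by Z0 + Y Z0 S changes the Gram matrix G of u, v into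
   G + Y skew2 - skew2 Y^T, and skew2 squares to -1. *)
pose Y := 2^-1 *: (G *m skew2 K).
pose Z := Z0 + Y *m Z0 *m C *m V.
have SC (X : 'M_(2, n)) : X *m C *m V *m C = 0 by rewrite -!mulmxA (mulmxA C) CVC mulmx0.
have ZC : Z *m C = Z0 *m C by rewrite mulmxDl SC addr0.
have CZ : C *m Z^T = C *m Z0^T.
  by rewrite -[LHS]trmxK trmx_mul trmxK sC mulmxN ZC linearN /= trmx_mul sC mulNmx opprK.
have ZCZ : Z *m C *m Z^T = skew2 K by rewrite -mulmxA CZ mulmxA ZC.
have ZWZ : Z *m W *m Z^T = 0.
  have e1 : Z *m W = Z0 *m W + Y *m Z0 *m C by rewrite mulmxDl mulmxKV.
  have e2 : W *m Z^T = W *m Z0^T - C *m Z0^T *m Y^T.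
    by rewrite linearD /= mulmxDr !trmx_mul VT sC !mulmxA mulmxV // mul1mx
      !(mulNmx, mulmxN) -!mulmxA.
  have YJ : Y *m skew2 K = - (2^-1 *: G).
    by rewrite /Y -scalemxAl -mulmxA J2 mulmxN mulmx1 scalerN.
  have JY : skew2 K *m Y^T = 2^-1 *: G.
    rewrite /Y linearZ /= trmx_mul JT GT -scalemxAr mulNmx mulmxN mulmxA J2.
    by rewrite mulNmx mul1mx opprK.
  rewrite e1 mulmxDl -mulmxA e2 mulmxBr mulmxA -/G.
  have -> : Z0 *m (C *m Z0^T *m Y^T) = 2^-1 *: G by rewrite !mulmxA Z0C JY.
  have -> : Y *m Z0 *m C *m Z^T = - (2^-1 *: G).
    by rewrite -!mulmxA CZ mulmxA -mulmxA (mulmxA Z0) Z0C YJ.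
  rewrite -addrA -opprD -scalerDl.
  by rewrite (_ : 2^-1 + 2^-1 = 1 :> K) ?scale1r ?subrr //; field.
(* The rows of Z pair with those of Z S through -skew2; the sign in T
   turns this pairing into J_2. *)
pose T := mx_of_rows 2 [:: [:: 1; 0]; [:: 0; -1 : K]].
have TT : T *m T = 1%:M.
  apply/matrixP => -[[|[|i]] hi] [[|[|j]] hj] //;
    by rewrite !mxE !big_ord_recl big_ord0 !mxE /=; ring.
have TtT : T^T = T by apply/matrixP => -[[|[|i]] hi] [[|[|j]] hj] //; rewrite !mxE.
have TJ : T *m skew2 K = antidiag K 2.
  apply/matrixP => -[[|[|i]] hi] [[|[|j]] hj] //;
    by rewrite !mxE !big_ord_recl big_ord0 !mxE /=; ring.
pose Z2 := T *m Z *m C *m V.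
pose P1 := col_mx Z Z2.
have P1C : P1 *m C = col_mx (Z *m C) 0 by rewrite mul_col_mx /Z2 SC.
have P1W : P1 *m W = col_mx (Z *m W) (T *m Z *m C) by rewrite mul_col_mx mulmxKV.
have CZ2 : C *m Z2^T = 0.
  by apply: trmx_inj; rewrite trmx_mul trmxK sC mulmxN SC oppr0 trmx0.
have GC : P1 *m C *m P1^T = skew_diagmx (2 + 2) 1.
  rewrite col_congr -!(mulmxA _ C) CZ2 !mulmx0 !mulmxA ZCZ SC mul0mx.
  exact: skew_diagmx_block.
have TZCZ : Z2 *m W *m Z^T = antidiag K 2.
  by rewrite mulmxKV // -!mulmxA (mulmxA Z) ZCZ TJ.
have GW : P1 *m W *m P1^T = antidiag K (2 + 2).
  rewrite col_congr ZWZ TZCZ -antidiag_block; congr block_mx.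
    by apply: trmx_inj; rewrite (trmx_mul _ Z2^T) trmxK trmx_mul sW mulmxA TZCZ tr_antidiag.
  by rewrite mulmxKV // -mulmxA CZ2 mulmx0.
have [||n2 [W2 [C2 [sp2 cF]]]] := skew_pair_split (P1 := P1) sp.
- by rewrite GW antidiag_unit.
- exists (block_mx 0 T 0 0).
  rewrite P1C -mulmxA P1W mul_block_col !(mul0mx, add0r, addr0).
  by rewrite !mulmxA TT mul1mx.
have en := cong_size cF; subst n.
have [|k [kn _ cq]] := IH n2 _ _ _ sp2; first by lia.
exists k.+1; split=> //; first by lia.
apply: (cong_trans cF); rewrite GW GC.
apply: (cong_trans (cong_sym (mxpair_diag _ _ _ _))).
apply: (cong_trans (cong_diag (cong_refl _) cq)).
apply: (cong_reindex erefl (@nest_inj 2 2 n2)) => -[] i j /=.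
  exact: antidiag_nest.
by apply: skew_diagmx_nest; lia.
Qed.

End Nested.

(** * Maps between two symmetric spaces with isotropic images *)

Section Triples.
Variable K : numFieldType.
Hypothesis sqrtK : forall x : K, exists y, y ^+ 2 = x.

(** Independent changes of basis in the two eigenspaces of an involution. *)
Definition tri_cong p q p' q' (Up : 'M[K]_p) (Uq : 'M[K]_q) (B : 'M[K]_(p, q))
    (Up' : 'M[K]_p') (Uq' : 'M[K]_q') (B' : 'M[K]_(p', q')) : Prop :=
  exists P Pi Q Qi, [/\ inverse_pair P Pi, inverse_pair Q Qi, Up' = P *m Up *m P^T,
    Uq' = Q *m Uq *m Q^T & B' = P *m B *m Q^T].

Lemma tri_cong_trans p q p1 q1 p2 q2 (Up : 'M[K]_p) (Uq : 'M[K]_q) B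
   (Up1 : 'M[K]_p1) (Uq1 : 'M[K]_q1) B1 (Up2 : 'M[K]_p2) (Uq2 : 'M[K]_q2) B2 :
  tri_cong Up Uq B Up1 Uq1 B1 -> tri_cong Up1 Uq1 B1 Up2 Uq2 B2 ->
  tri_cong Up Uq B Up2 Uq2 B2.
Proof.
move=> [P [Pi [Q [Qi [PP QQ -> -> ->]]]]] [P' [Pi' [Q' [Qi' [PP' QQ' -> -> ->]]]]].
exists (P' *m P), (Pi *m Pi'), (Q' *m Q), (Qi *m Qi').
by split; rewrite ?trmx_mul ?mulmxA //; exact: inverse_pair_mul.
Qed.

Lemma tri_cong_diag p q p1 q1 m n (Vp : 'M[K]_m) (Vq : 'M[K]_n) C
   (Up : 'M[K]_p) (Uq : 'M[K]_q) B (Up1 : 'M[K]_p1) (Uq1 : 'M[K]_q1) B1 :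
  tri_cong Up Uq B Up1 Uq1 B1 ->
  tri_cong (diag2 Vp Up) (diag2 Vq Uq) (block_mx C 0 0 B)
           (diag2 Vp Up1) (diag2 Vq Uq1) (block_mx C 0 0 B1).
Proof.
move=> [P [Pi [Q [Qi [PP QQ -> -> ->]]]]].
exists (block_mx 1%:M 0 0 P), (block_mx 1%:M 0 0 Pi),
  (block_mx 1%:M 0 0 Q), (block_mx 1%:M 0 0 Qi).
split; try exact: inverse_pair_diag (invpair1 _ _) _;
  by rewrite /diag2 tr_block_mx !mulmx_block
    !(trmx0, trmx1, mulmx0, mul0mx, mul1mx, mulmx1, addr0, add0r).
Qed.

(** The operator with off-diagonal blocks B and B^T is self-adjoint of
    square zero: its images in both spaces are isotropic. *)
Definition isotropic p q (Up : 'M[K]_p) (Uq : 'M[K]_q) (B : 'M[K]_(p, q)) : Prop :=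
  [/\ Up^T = Up /\ Uq^T = Uq, Up \in unitmx /\ Uq \in unitmx,
      B *m invmx Uq *m B^T = 0 & B^T *m invmx Up *m B = 0].

Lemma isotropic_cong p q p' q' (Up : 'M[K]_p) (Uq : 'M[K]_q) B
   (Up' : 'M[K]_p') (Uq' : 'M[K]_q') B' :
  tri_cong Up Uq B Up' Uq' B' -> isotropic Up Uq B -> isotropic Up' Uq' B'.
Proof.
move=> [P [Pi [Q [Qi [PP QQ -> -> ->]]]]] [[sp sq] [up uq] hp hq].
have [uP eP] := congr_unit PP up; have [uQ eQ] := congr_unit QQ uq.
have [_ tP] := inverse_pair_tr PP; have [_ tQ] := inverse_pair_tr QQ.
have [_ iP] := PP; have [_ iQ] := QQ.
split=> //; first by split; exact: congr_sym.
- rewrite eQ !trmx_mul trmxK !mulmxA -(mulmxA _ Q^T) tQ mulmx1.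
  by rewrite -(mulmxA _ Qi Q) iQ mulmx1 -!(mulmxA P) hp !(mulmx0, mul0mx).
- rewrite eP !trmx_mul trmxK !mulmxA -(mulmxA _ P^T) tP mulmx1.
  by rewrite -(mulmxA _ Pi P) iP mulmx1 -!(mulmxA Q) hq !(mulmx0, mul0mx).
Qed.

Lemma isotropic_diag p q m n (Vp : 'M[K]_m) (Vq : 'M[K]_n) C
   (Up : 'M[K]_p) (Uq : 'M[K]_q) B :
  isotropic (diag2 Vp Up) (diag2 Vq Uq) (block_mx C 0 0 B) -> isotropic Up Uq B.
Proof.
move=> [[sp sq] [up uq] hp hq].
have [uVp uUp] := unit_diag up; have [uVq uUq] := unit_diag uq.
split=> //.
- move: sp sq; rewrite /diag2 !tr_block_mx.
  by move=> /eq_block_mx[_ _ _ ->] /eq_block_mx[_ _ _ ->].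
- move: hp; rewrite /diag2 (invmx_block_diag uq) tr_block_mx !mulmx_block.
  rewrite !(trmx0, mulmx0, mul0mx, addr0, add0r) -[RHS]block_mx0.
  by case/eq_block_mx.
- move: hq; rewrite /diag2 (invmx_block_diag up) tr_block_mx !mulmx_block.
  rewrite !(trmx0, mulmx0, mul0mx, addr0, add0r) -[RHS]block_mx0.
  by case/eq_block_mx.
Qed.

Lemma tri_split p q d e (Up : 'M[K]_p) (Uq : 'M[K]_q) B
   (P1 : 'M_(d, p)) (Q1 : 'M_(e, q)) M N : isotropic Up Uq B ->
  P1 *m Up *m P1^T \in unitmx -> Q1 *m Uq *m Q1^T \in unitmx ->
  P1 *m B = M *m Q1 *m Uq -> Q1 *m B^T = N *m P1 *m Up ->
  exists p2 q2 (Up2 : 'M_p2) (Uq2 : 'M_q2) B2, isotropic Up2 Uq2 B2 /\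
    tri_cong Up Uq B (diag2 (P1 *m Up *m P1^T) Up2) (diag2 (Q1 *m Uq *m Q1^T) Uq2)
       (block_mx (P1 *m B *m Q1^T) 0 0 B2).
Proof.
move=> iso uP uQ PB QB; have [[sp sq] [up uq] _ _] := iso.
have [p2 [P2 [Pi [PP oP]]]] := orth_compl sp uP.
have [q2 [Q2 [Qi [QQ oQ]]]] := orth_compl sq uQ.
exists p2, q2, (P2 *m Up *m P2^T), (Q2 *m Uq *m Q2^T), (P2 *m B *m Q2^T).
suff c : tri_cong Up Uq B (diag2 (P1 *m Up *m P1^T) (P2 *m Up *m P2^T))
    (diag2 (Q1 *m Uq *m Q1^T) (Q2 *m Uq *m Q2^T))
    (block_mx (P1 *m B *m Q1^T) 0 0 (P2 *m B *m Q2^T)).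
  by split=> //; exact: isotropic_diag (isotropic_cong c iso).
have oP' : P2 *m Up *m P1^T = 0.
  by apply: trmx_inj; rewrite trmx0 !trmx_mul trmxK sp mulmxA.
have oQ' : Q2 *m Uq *m Q1^T = 0.
  by apply: trmx_inj; rewrite trmx0 !trmx_mul trmxK sq mulmxA.
exists (col_mx P1 P2), Pi, (col_mx Q1 Q2), Qi; split=> //.
- by rewrite col_congr /diag2 oP oP'.
- by rewrite col_congr /diag2 oQ oQ'.
rewrite tr_col_mx mul_col_mx mul_col_row; congr block_mx.
- by rewrite PB -!mulmxA (mulmxA Q1) oQ mulmx0.
- apply: trmx_inj; rewrite trmx0 !trmx_mul trmxK mulmxA QB.
  by rewrite -!mulmxA (mulmxA P1) oP mulmx0.
Qed.

(** b(u + c w, u + c w) = b(u, u) + 2 c. *)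
Lemma adjust_isotropic n (U : 'M[K]_n) (u w : 'rV_n) : U^T = U ->
  u *m U *m w^T = 1%:M -> w *m U *m w^T = 0 ->
  exists c, (u + c *: w) *m U *m (u + c *: w)^T = 0.
Proof.
move=> sU uw ww; have [a uu] : exists a, u *m U *m u^T = a%:M.
  by exists ((u *m U *m u^T) 0 0); exact: mx11_scalar.
exists (- a / 2).
have wu : w *m U *m u^T = 1%:M.
  by apply: trmx_inj; rewrite !trmx_mul trmxK sU trmx1 mulmxA.
rewrite linearD linearZ /= !mulmxDl !mulmxDr -!scalemxAl -!scalemxAr ww uw wu.
rewrite uu !scaler0 addr0 !scale_scalar_mx -!raddfD /=.
rewrite -[RHS](raddf0 (@scalar_mx K 1)).
by congr (_%:M); field.
Qed.

(** Diag(J_p, 1_l) written with natural number indices. *)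
Definition antidiag_long p l : 'M[K]_(p + l) := \matrix_(i, j)
  (if (i < p)%N then ((i + j).+1 == p)%N else (i == j :> nat))%:R.

Lemma antidiag_longE p l : antidiag_long p l = diag2 (antidiag K p) 1%:M.
Proof.
have b0 (b : bool) : b = false -> b%:R = 0 :> K by move->.
apply/matrixP => i j; rewrite mxE.
case: (split_ordP i) => a ->; case: (split_ordP j) => b ->;
  rewrite ?(block_mxEul, block_mxEur, block_mxEdl, block_mxEdr) mxE /=;
  have := ltn_ord a; have := ltn_ord b => hb ha; rewrite -?val_eqE /=.
- by [].
- by apply: b0; lia.
- by apply: b0; lia.
- by rewrite eqn_add2l.
Qed.

(** Wrapping a hyperbolic plane around the first p of p + l indices. *)
Definition nest_long_nat p i : nat := if (i < 2 + p)%N then nest_nat 1 1 p i else i.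

Lemma nest_long_ltn p l (i : 'I_(1 + 1 + (p + l))) :
  (nest_long_nat p i < 1 + 1 + p + l)%N.
Proof.
rewrite /nest_long_nat /nest_nat; have := ltn_ord i.
by case: (ltnP i 1); case: (ltnP i (1 + 1)); case: (ltnP i (2 + p)); lia.
Qed.

Definition nest_long p l (i : 'I_(1 + 1 + (p + l))) : 'I_(1 + 1 + p + l) :=
  Ordinal (nest_long_ltn i).

Lemma nest_long_inj p l : injective (@nest_long p l).
Proof.
move=> i j []; rewrite /nest_long_nat /nest_nat => e; apply: val_inj => /=.
move: e; have := ltn_ord i; have := ltn_ord j.
by case: (ltnP i 1); case: (ltnP i (1 + 1)); case: (ltnP i (2 + p));
  case: (ltnP j 1); case: (ltnP j (1 + 1)); case: (ltnP j (2 + p)); lia.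
Qed.

Lemma antidiag_long_nest p l (i j : 'I_(1 + 1 + (p + l))) :
  antidiag_long (1 + 1 + p) l (nest_long i) (nest_long j) =
  diag2 (antidiag K (1 + 1)) (antidiag_long p l) i j.
Proof.
rewrite /diag2 /antidiag /antidiag_long (block_natE (fun i j => ((i + j).+1 == _)%:R)
  (fun i j => (if (i < p)%N then (i + j).+1 == p else i == j)%:R)) mxE /=.
rewrite /nest_long_nat /nest_nat.
have b0 (b : bool) : b = false -> b%:R = 0 :> K by move->.
have := ltn_ord i; have := ltn_ord j.
case: (ltnP i 1); case: (ltnP i (1 + 1)); case: (ltnP i (2 + p));
  case: (ltnP j 1); case: (ltnP j (1 + 1)); case: (ltnP j (2 + p)); move=> *;
  try (by exfalso; lia); repeat (case: ifP => ?);
  solve [congr (nat_of_bool _)%:R; lia | apply: b0; lia | by exfalso; lia].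
Qed.

Lemma pid_mx_nest p l k (i : 'I_(1 + 1 + p)) (j : 'I_(1 + 1 + (p + l))) :
  (k <= p)%N ->
  (pid_mx k.+1 : 'M[K]_(1 + 1 + p, 1 + 1 + p + l)) (nest i) (nest_long j) =
  block_mx (pid_mx 1 : 'M_(1 + 1)) 0 0 (pid_mx k : 'M_(p, p + l)) i j.
Proof.
move=> kp.
have pidE m n r : pid_mx r =
    \matrix_(i < m, j < n) ((i == j :> nat) && (i < r)%N)%:R :> 'M[K]_(m, n).
  by apply/matrixP => a b; rewrite !mxE.
rewrite !pidE (block_natE (fun i j => ((i == j) && (i < 1)%N)%:R)
  (fun i j => ((i == j) && (i < k)%N)%:R)) mxE /= /nest_long_nat /nest_nat.
have b0 (b : bool) : b = false -> b%:R = 0 :> K by move->.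
have := ltn_ord i; have := ltn_ord j.
case: (ltnP i 1); case: (ltnP i (1 + 1)); 
  case: (ltnP j 1); case: (ltnP j (1 + 1)); case: (ltnP j (2 + p)); move=> *;
  try (by exfalso; lia);
  solve [congr (nat_of_bool _)%:R; lia | apply: b0; lia].
Qed.

(** For u B v^T = 1, the vector v B^T Up^-1 is isotropic and pairs with u,
    and u B Uq^-1 is isotropic and pairs with v.  After adjusting u and v
    both pairs are hyperbolic planes, and B links only u with v.  Each of the
    k steps uses 2 of the p dimensions, whence 2 k <= p; when B vanishes the
    remaining forms are brought to the anti-diagonal shape. *)
Lemma isotropic_triple p q (Up : 'M[K]_p) (Uq : 'M[K]_q) B :
  isotropic Up Uq B -> (p <= q)%N ->
  exists k l, [/\ (2 * k <= p)%N, q = (p + l)%N, B != 0 -> (0 < k)%N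
    & tri_cong Up Uq B (antidiag K p) (antidiag_long p l) (pid_mx k : 'M_(p, p + l))].
Proof.
elim/ltn_ind: p q Up Uq B => p IH q Up Uq B iso pq.
have [[sp sq] [up uq] hp hq] := iso.
have [B0|B0] := eqVneq B 0.
  have [l el] : exists l, q = (p + l)%N by exists (q - p)%N; rewrite subnKC.
  subst q; exists 0%N, l; split=> //.
  have [P [Pi [PP /(_ tt) eP]]] :=
    cong_sym_unit sqrtK sp up (tr_antidiag K p) (antidiag_unit K p).
  have [||Q [Qi [QQ /(_ tt) eQ]]] := @cong_sym_unit _ sqrtK _ Uq (antidiag_long p l) sq uq.
  - by rewrite antidiag_longE /diag2 tr_block_mx tr_antidiag trmx1 !trmx0.
  - by rewrite antidiag_longE block_diag_mx_unit antidiag_unit unitmx1.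
  exists P, Pi, Q, Qi; split=> //.
  by rewrite B0 mulmx0 mul0mx pid_mx_0.
have [u0 [v0 uBv]] := exists_pairing B0.
have vBu : v0 *m B^T *m u0^T = 1%:M.
  by apply: trmx_inj; rewrite !trmx_mul !trmxK trmx1 mulmxA.
pose Vp := invmx Up; pose Vq := invmx Uq.
have VpT : Vp^T = Vp by rewrite trmx_inv sp.
have VqT : Vq^T = Vq by rewrite trmx_inv sq.
have hp' m (X : 'M_(m, _)) : X *m B *m Vq *m B^T = 0.
  by rewrite -!mulmxA (mulmxA B) hp mulmx0.
have hq' m (X : 'M_(m, _)) : X *m B^T *m Vp *m B = 0.
  by rewrite -!mulmxA (mulmxA B^T) hq mulmx0.
have [c uu] : exists c, (u0 + c *: (v0 *m B^T *m Vp)) *m Up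
     *m (u0 + c *: (v0 *m B^T *m Vp))^T = 0.
  apply: adjust_isotropic => //.
    by rewrite !trmx_mul trmxK VpT !mulmxA mulmxK.
  by rewrite mulmxKV // !trmx_mul VpT trmxK !mulmxA hq' mul0mx.
have [d vv] : exists d, (v0 + d *: (u0 *m B *m Vq)) *m Uq
     *m (v0 + d *: (u0 *m B *m Vq))^T = 0.
  apply: adjust_isotropic => //.
    by rewrite !trmx_mul VqT !mulmxA mulmxK // -[RHS]trmx1 -vBu !trmx_mul !trmxK mulmxA.
  by rewrite mulmxKV // !trmx_mul VqT !mulmxA hp' mul0mx.
set u := u0 + _ in uu; set v := v0 + _ in vv.
have uB : u *m B = u0 *m B by rewrite mulmxDl -scalemxAl hq' scaler0 addr0.
have vB : v *m B^T = v0 *m B^T by rewrite mulmxDl -scalemxAl hp' scaler0 addr0.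
have uv1 : u *m B *m v^T = 1%:M.
  rewrite uB -mulmxA -[B *m v^T]trmxK trmx_mul trmxK vB trmx_mul !trmxK.
  by rewrite mulmxA.
have vu1 : v *m B^T *m u^T = 1%:M.
  by apply: trmx_inj; rewrite !trmx_mul !trmxK trmx1 mulmxA.
pose P1 := col_mx u (v *m B^T *m Vp); pose Q1 := col_mx v (u *m B *m Vq).
have J1 : antidiag K (1 + 1) = block_mx 0 1%:M 1%:M 0.
  rewrite -antidiag_block (_ : antidiag K 1 = 1%:M) //.
  by apply/matrixP => i j; rewrite !mxE !ord1.
have GP : P1 *m Up *m P1^T = antidiag K (1 + 1).
  rewrite /P1 col_congr mulmxKV // uu J1 !trmx_mul VpT trmxK !mulmxA hq' mul0mx.
  by rewrite mulmxK // uv1 vu1.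
have GQ : Q1 *m Uq *m Q1^T = antidiag K (1 + 1).
  rewrite /Q1 col_congr mulmxKV // vv J1 !trmx_mul VqT !mulmxA hp' mul0mx.
  by rewrite mulmxK // uv1 vu1.
have GB : P1 *m B *m Q1^T = pid_mx 1.
  rewrite /P1 /Q1 tr_col_mx mul_col_mx mul_col_row hq' !mul0mx uv1.
  by rewrite !trmx_mul VqT !mulmxA hp' mul0mx pid_mx_block.
have PB : P1 *m B = block_mx 0 1%:M 0 0 *m Q1 *m Uq.
  rewrite -[RHS]mulmxA (_ : Q1 *m Uq = col_mx (v *m Uq) (u *m B)); last first.
    by rewrite /Q1 mul_col_mx mulmxKV.
  rewrite mul_block_col !mul0mx mul1mx add0r addr0.
  by rewrite /P1 mul_col_mx hq'.
have QB : Q1 *m B^T = block_mx 0 1%:M 0 0 *m P1 *m Up.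
  rewrite -[RHS]mulmxA (_ : P1 *m Up = col_mx (u *m Up) (v *m B^T)); last first.
    by rewrite /P1 mul_col_mx mulmxKV.
  rewrite mul_block_col !mul0mx mul1mx add0r addr0.
  by rewrite /Q1 mul_col_mx hp'.
have [||p2 [q2 [Up2 [Uq2 [B2 [iso2 tc]]]]]] := tri_split iso _ _ PB QB.
- by rewrite GP antidiag_unit.
- by rewrite GQ antidiag_unit.
rewrite GP GQ GB in tc.
have [ep eq] : p = (1 + 1 + p2)%N /\ q = (1 + 1 + q2)%N.
  by case: tc => [P [Pi [Q [Qi [/inverse_pair_size e1 /inverse_pair_size e2 _ _ _]]]]].
subst p q.
have [||k [l [kp2 eq2 _ tc2]]] := IH p2 _ _ _ _ _ iso2; [lia|lia|subst q2].
exists k.+1, l; split=> //; first by lia.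
apply: (tri_cong_trans tc); apply: (tri_cong_trans (tri_cong_diag _ _ _ tc2)).
exists (relabel K (@nest 1 1 p2)), (relabel K (@nest 1 1 p2))^T,
  (relabel K (@nest_long p2 l)), (relabel K (@nest_long p2 l))^T.
have el : (1 + 1 + (p2 + l) = 1 + 1 + p2 + l)%N by lia.
split.
- exact: relabel_invpair (@nest_inj _ _ _).
- exact: relabel_invpair (@nest_long_inj _ _).
- apply: relabelE => //; [exact: nest_inj|exact: nest_inj|].
  by move=> a b; exact: antidiag_nest.
- apply: relabelE => //; [exact: nest_long_inj|exact: nest_long_inj|].
  by move=> a b; exact: antidiag_long_nest.
- apply: relabelE => //; [exact: nest_inj|exact: nest_long_inj|].
  by move=> a b; apply: pid_mx_nest; lia.
Qed.

End Triples.

(** * Normal forms for the spin factors *)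

Section SpinCases.
Variable K : numFieldType.
Hypothesis sqrtK : forall x : K, exists y, y ^+ 2 = x.
Local Notation K4 := (K * K * K * K)%type.
Local Notation KJ := (comJ K^o).

(** The common shape of an embedding of a spin factor whose first two
    generators are involutions, in terms of the pair (W, C) of spin_double. *)
Definition hblock n (W C : 'M[K]_n) (x y z w : K) : 'M[K]_(n + n) :=
  block_mx (x *: W) (z *: W + w *: C) (z *: W - w *: C) (y *: W).

Lemma hblock_cong m n (W C : 'M[K]_m) (W' C' : 'M[K]_n) I (x y z w : I -> K) :
  cong (mxpair W C) (mxpair W' C') ->
  cong (fun t => hblock W C (x t) (y t) (z t) (w t))
       (fun t => hblock W' C' (x t) (y t) (z t) (w t)).
Proof.
move=> [P [Q [PQ e]]].
have eW : W' = P *m W *m P^T by exact: (e true).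
have eC : C' = P *m C *m P^T by exact: (e false).
exists (block_mx P 0 0 P), (block_mx Q 0 0 Q); split; first exact: inverse_pair_diag.
move=> t; rewrite /hblock tr_block_mx !mulmx_block eW eC.
rewrite !(trmx0, mulmx0, mul0mx, addr0, add0r) !(mulmxDl, mulmxDr, mulmxN, mulNmx).
by rewrite -!(scalemxAl, scalemxAr).
Qed.

Lemma embeds_pos (A : jordanAlg K) n (f : A -> 'M[K]_n) (x : A) : embeds f ->
  x != 0 -> (0 < n)%N.
Proof.
move=> ef; have [[_ injf] _ _ _] := ef; case: n f ef injf => // f ef injf.
by case/eqP; apply: injf; rewrite [LHS]flatmx0 [RHS]flatmx0.
Qed.

(** The coordinates x and y are the values of the element on the two
    eigenspaces of the first generator. *)
Definition spin_point d r (x y : K) (s : seq K) : spinJ K d r :=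
  ((x + y) / 2, \row_(i < d) ((x - y) / 2 :: s)`_i).

Lemma spin_pointP d r (x y : K) s : let a := spin_point d.+1 r x y s in
  [/\ a.1 + a.2 0 0 = x, a.1 - a.2 0 0 = y &
      forall i : 'I_d, a.2 0 (lift ord0 i) = s`_i].
Proof.
by split=> [||i]; rewrite /= !mxE //=; field.
Qed.

Lemma spin_point_surj d r (a : spinJ K d.+1 r) :
  a = spin_point d.+1 r (a.1 + a.2 0 0) (a.1 - a.2 0 0)
        (mkseq (fun i => a.2 0 (inord i.+1)) d).
Proof.
case: a => x v; congr pair; first by rewrite /=; field.
apply/rowP => i; rewrite mxE /=; case: (unliftP ord0 i) => [j|] -> /=.
  rewrite nth_mkseq ?ltn_ord //; congr (fun_of_matrix v _ _); apply: val_inj.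
  by rewrite /= inordK // ltnS ltn_ord.
rewrite (_ : ord0 = 0) //; have : (x : K) + v 0 0 - (x - v 0 0) = v 0 0 * 2 by ring.
by move->; rewrite mulfK ?two_neq0.
Qed.

Lemma tens_mx2 p :
  cong (fun t : K4 => block_mx (t.1.1.1 *: 1%:M : 'M[K]_p) (t.1.1.2 *: 1%:M)
                                (t.1.1.2 *: 1%:M) (t.1.2 *: 1%:M))
       (fun t => mx_of_rows 2 [:: [:: t.1.1.1; t.1.1.2]; [:: t.1.1.2; t.1.2]]
                 *t (1%:M : 'M_p)).
Proof.
have e : (p + p = 2 * p)%N by rewrite mul2n addnn.
apply: (cong_reindex (s := cast_ord e) e); first exact: cast_ord_inj.
have el (a : 'I_p) : cast_ord e (lshift p a) = mxtens_index (ord0 : 'I_2, a).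
  by apply: val_inj; rewrite /= mul0n.
have er (a : 'I_p) : cast_ord e (rshift p a) = mxtens_index (ord_max : 'I_2, a).
  by apply: val_inj; rewrite /= mul1n.
move=> t i j; case: (split_ordP i) => a ->; case: (split_ordP j) => b ->;
  rewrite ?(block_mxEul, block_mxEur, block_mxEdl, block_mxEdr) ?(el, er) tensmxE;
  by rewrite !mxE.
Qed.

Lemma embedding_K_J22 n (L : set 'M[K]_n) :
  is_embedding (prodJ KJ (spinJ K 2 2)) L ->
  exists k1 k2 : nat,
    [/\ (1 <= k1)%N, (1 <= k2)%N, (k1 + 2 * k2 = n)%N
      & congruent L (B1 K k1 k2)].
Proof.
move=> /is_embeddingP[f [ef ->]].
have [k1 [m [f1 [f2 [/(embeds_scalar sqrtK)[k1_gt0 c1] ef2 cf]]]]] := embeds_prod ef.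
have m_gt0 : (0 < m)%N.
  apply: (embeds_pos ef2 (x := jone _)); apply/eqP => -[/eqP].
  exact/negP/oner_neq0.
have [p [W [C [sW uW _ _ c2]]]] := spin_double ef2.
have [P [Q [PQ /(_ tt) eW]]] := cong_one sqrtK sW uW.
have cW : cong (mxpair W 0) (mxpair 1%:M (0 : 'M_p)).
  by exists P, Q; split=> // -[] //=; rewrite mulmx0 mul0mx.
pose c (t : K4) : prodJ KJ (spinJ K 2 2) :=
  (t.2, spin_point 2 2 t.1.1.1 t.1.2 [:: t.1.1.2]).
have c2' : cong (fun t => f2 (c t).2) (fun t =>
    mx_of_rows 2 [:: [:: t.1.1.1; t.1.1.2]; [:: t.1.1.2; t.1.2]] *t (1%:M : 'M_p)).
  apply: cong_trans (tens_mx2 p).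
  apply: (cong_trans (cong_comp (fun t => (c t).2) c2)).
  apply: (cong_trans _ (cong_trans (hblock_cong (fun t : K4 => t.1.1.1) (fun t => t.1.2)
    (fun t => t.1.1.2) (fun _ => 0) cW) _)); apply: cong_eq => t.
    have [-> -> h] := spin_pointP 1 2 t.1.1.1 t.1.2 [:: t.1.1.2].
    by rewrite h !big_ord0 /hblock scaler0.
  by rewrite /hblock scaler0 addr0 subr0.
have cff := cong_trans (cong_comp c cf) (cong_diag (cong_comp (fun t => (c t).1) c1) c2').
exists k1, p; split=> //; last 2 first.
- by rewrite (cong_size cff).
- apply: (congruent_family4 _ cff) => -[w a].
  exists (a.1 + a.2 0 0, a.2 0 (inord 1), a.1 - a.2 0 0, w).
  by congr pair; exact: spin_point_surj.
by move: (cong_size c2) m_gt0; case: (p) => // ->.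
Qed.

Lemma cong_swap_block p q I (A : I -> 'M[K]_p) (B : I -> 'M[K]_(p, q)) 
   (B' : I -> 'M[K]_(q, p)) (D : I -> 'M[K]_q) :
  cong (fun t => block_mx (A t) (B t) (B' t) (D t))
       (fun t => block_mx (D t) (B' t) (B t) (A t)).
Proof.
exists (block_mx 0 1%:M 1%:M 0), (block_mx 0 1%:M 1%:M 0); split.
  by split; rewrite mulmx_block !(mulmx0, mul0mx, addr0, add0r, mulmx1)
    -scalar_mx_block.
move=> i; rewrite tr_block_mx !mulmx_block.
by rewrite !(trmx0, trmx1, mulmx0, mul0mx, addr0, add0r, mulmx1, mul1mx).
Qed.

Lemma isotropic_tr p q (Up : 'M[K]_p) (Uq : 'M[K]_q) B :
  isotropic Up Uq B -> isotropic Uq Up B^T.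
Proof. by case=> -[sp sq] [up uq] hp hq; split; rewrite ?trmxK. Qed.

Lemma pid_mx_widen p l k : (k <= p)%N ->
  pid_mx k = row_mx (pid_mx k) 0 :> 'M[K]_(p, p + l).
Proof.
move=> kp; apply/matrixP => i j; rewrite !mxE; case: split_ordP => a -> /=.
  by rewrite mxE.
rewrite mxE (_ : (_ == _) = false) //; apply/eqP => e.
by have := ltn_ord i; rewrite e ltnNge leq_addr.
Qed.

(** The l extra dimensions of the larger eigenspace form the last block,
    on which only the coordinate y is seen. *)
Lemma isotropic_block_form p q (Up : 'M[K]_p) (Uq : 'M[K]_q) B :
  isotropic Up Uq B -> B != 0 -> (p <= q)%N ->
  exists k l, [/\ (1 <= k)%N, (2 * k <= p)%N &
    cong (fun t : K4 => block_mx (t.1.1.1 *: Up) (t.1.2 *: B)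
                                 (t.1.2 *: B^T) (t.1.1.2 *: Uq))
     (fun t => diag2 (block_mx (t.1.1.1 *: antidiag K p) (t.1.2 *: pid_mx k)
                          (t.1.2 *: pid_mx k) (t.1.1.2 *: antidiag K p))
                (t.1.1.2 *: 1%:M : 'M_l))].
Proof.
move=> iso B0 pq; have [k [l [kp _ /(_ B0) k0 tc]]] := isotropic_triple sqrtK iso pq.
exists k, l; split=> //; have [P [Pi [Q [Qi [PP QQ eP eQ eB]]]]] := tc.
apply: (@cong_trans _ _ _ _ _ _ (fun t : K4 =>
   block_mx (t.1.1.1 *: antidiag K p) (row_mx (t.1.2 *: pid_mx k) 0)
            (col_mx (t.1.2 *: pid_mx k) 0)
            (block_mx (t.1.1.2 *: antidiag K p) 0 0 (t.1.1.2 *: (1%:M : 'M_l))))).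
  exists (block_mx P 0 0 Q), (block_mx Pi 0 0 Qi); split.
    exact: inverse_pair_diag.
  move=> t; rewrite tr_block_mx !mulmx_block.
  rewrite !(trmx0, mulmx0, mul0mx, addr0, add0r) -!scalemxAr -!scalemxAl.
  have eBT : Q *m B^T *m P^T = (pid_mx k : 'M_(p, p + l))^T.
    by rewrite eB !trmx_mul trmxK mulmxA.
  rewrite eBT -eP -eQ -eB antidiag_longE /diag2 tr_pid_mx.
  congr block_mx.
  - by rewrite pid_mx_widen ?scale_row_mx ?scaler0 //; lia.
  - rewrite -[pid_mx k in RHS]tr_pid_mx pid_mx_widen; last by lia.
    by rewrite tr_row_mx trmx0 tr_pid_mx scale_col_mx scaler0.
  - by rewrite scale_block_mx !scaler0.
apply: (cong_trans (cong_cast (addnA p p l) _)); apply: cong_eq => t.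
rewrite /diag2.
have := @block_mxA _ p p l p p l (t.1.1.1 *: antidiag K p) (t.1.2 *: pid_mx k) 0
  (t.1.2 *: pid_mx k) (t.1.1.2 *: antidiag K p) 0 0 0 (t.1.1.2 *: 1%:M).
rewrite row_mx0 col_mx0 => /= ->.
by apply: (canLR (castmxKV _ _)); congr castmx; congr pair; apply: eq_irrelevance.
Qed.

Lemma embedding_K_J21 n (L : set 'M[K]_n) :
  is_embedding (prodJ KJ (spinJ K 2 1)) L ->
  exists r k l1 l2 : nat,
    [/\ (1 <= r)%N, (2 <= l2)%N, (1 <= k)%N /\ (2 * k <= l2)%N,
        (r + (l1 + 2 * l2) = n)%N
      & congruent L (B2 K r k l1 l2)].
Proof.
move=> /is_embeddingP[f [ef ->]].
have [r [m [f1 [f2 [/(embeds_scalar sqrtK)[r_gt0 c1] ef2 cf]]]]] := embeds_prod ef.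
have [p [q [Up [Uq [B [[sp sq up uq] rp rq c2]]]]]] := spin_split ef2.
have iso : isotropic Up Uq (B ord0).
  split=> //.
    have := rp ord0 ord0; rewrite andbF mulr0 scale0r => /eqP.
    by rewrite addr_eq0 => /eqP/mxopp_eq0.
  have := rq ord0 ord0; rewrite andbF mulr0 scale0r => /eqP.
  by rewrite addr_eq0 => /eqP/mxopp_eq0.
have B0 : B ord0 != 0.
  apply: contraNneq (oner_neq0 K) => B0.
  have [[_ injG] _ _ _] := embeds_cong c2 ef2.
  pose y s := spin_point 2 1 0 0 [:: s].
  have [y11 y12 y13] := spin_pointP 1 1 0 0 [:: 1 : K].
  have [y01 y02 y03] := spin_pointP 1 1 0 0 [:: 0 : K].
  have ey : y 1 = y 0.
    by apply: injG; rewrite y11 y12 y01 y02 !big_ord1 B0 trmx0 !scaler0.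
  by have := y13 ord0; rewrite -/(y 1) ey y03 => /eqP; rewrite eq_sym.
suff [k [l2 [l1 [c [cs k0 kl c2']]]]] :
  exists k l2 l1 (c : K4 -> spinJ K 2 1), 
   [/\ forall a, exists x y z, forall w, a = c (x, y, z, w),
       (1 <= k)%N, (2 * k <= l2)%N &
   cong (fun t => f2 (c t)) (fun t => diag2
     (block_mx (t.1.1.1 *: antidiag K l2) (t.1.2 *: pid_mx k)
               (t.1.2 *: pid_mx k) (t.1.1.2 *: antidiag K l2))
     (t.1.1.2 *: 1%:M : 'M_l1))].
  pose c' (t : K4) : prodJ KJ (spinJ K 2 1) := (t.2, c t).
  have cff := cong_trans (cong_comp c' cf) (cong_diag (cong_comp snd c1) c2').
  exists r, k, l1, l2; split=> //; first by lia.
    by rewrite (cong_size cff); ring.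
  apply: (congruent_family4 _ cff) => -[w a].
  have [x [y [z e]]] := cs a; exists (x, y, z, w).
  by rewrite /c' -e.
pose c (t : K4) := spin_point 2 1 t.1.1.1 t.1.1.2 [:: t.1.2].
pose c' (t : K4) := spin_point 2 1 t.1.1.2 t.1.1.1 [:: t.1.2].
have cP (x y z : K) := spin_pointP 1 1 x y [:: z].
have [pq|/ltnW qp] := leqP p q.
  have [k [l [k0 kp cc]]] := isotropic_block_form iso B0 pq.
  exists k, p, l, c; split=> //.
    move=> a; exists (a.1 + a.2 0 0), (a.1 - a.2 0 0), (a.2 0 (inord 1)) => w.
    exact: spin_point_surj.
  apply: cong_trans cc; apply: (cong_trans (cong_comp c c2)); apply: cong_eq => t.
  have [-> -> h] := cP t.1.1.1 t.1.1.2 t.1.2.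
  by rewrite !big_ord1 h.
(* If the first eigenspace is the larger one, exchanging the two
   eigenspaces exchanges x and y. *)
have B0' : (B ord0)^T != 0 by rewrite trmx_eq0.
have [k [l [k0 kp cc]]] := isotropic_block_form (isotropic_tr iso) B0' qp.
exists k, q, l, c'; split=> //.
  move=> a; exists (a.1 - a.2 0 0), (a.1 + a.2 0 0), (a.2 0 (inord 1)) => w.
  exact: spin_point_surj.
apply: cong_trans cc; apply: (cong_trans (cong_comp c' c2)).
apply: (cong_trans (cong_swap_block _ _ _ _)); apply: cong_eq => t.
have [-> -> h] := cP t.1.1.2 t.1.1.1 t.1.2.
by rewrite !big_ord1 h trmxK.
Qed.

Lemma spin3 r n (f : spinJ K 3 r.+2 -> 'M[K]_n) : embeds f ->
  exists p (W C : 'M[K]_p), [/\ skew_pair (- (0 < r)%N%:R) W C, C != 0 &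
    exists c : K4 -> spinJ K 3 r.+2, (forall a, exists t, a = c t) /\
      cong (fun t => f (c t)) (fun t => hblock W C t.1.1.1 t.1.1.2 t.1.2 t.2)].
Proof.
move=> ef; have [p [W [C [sW uW sC CC cf]]]] := spin_double ef.
exists p, W, (C ord0); split; first by split.
  apply: contraNneq (oner_neq0 K) => C0.
  have [[_ injG] _ _ _] := embeds_cong cf ef.
  pose y s := spin_point 3 r.+2 0 0 [:: 0; s].
  have [y11 y12 y13] := spin_pointP 2 r.+2 0 0 [:: 0; 1 : K].
  have [y01 y02 y03] := spin_pointP 2 r.+2 0 0 [:: 0; 0 : K].
  have ey : y 1 = y 0.
    by apply: injG; rewrite y11 y12 y13 y01 y02 y03 !big_ord1 C0 !scaler0.
  have := y13 (lift ord0 ord0); rewrite -/(y 1) ey y03 /= => /eqP.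
  by rewrite eq_sym.
exists (fun t => spin_point 3 r.+2 t.1.1.1 t.1.1.2 [:: t.1.2; t.2]); split.
  move=> a; exists (a.1 + a.2 0 0, a.1 - a.2 0 0, a.2 0 (inord 1), a.2 0 (inord 2)).
  exact: spin_point_surj.
apply: (cong_trans (cong_comp _ cf)); apply: cong_eq => t.
have [-> -> h] := spin_pointP 2 r.+2 t.1.1.1 t.1.1.2 [:: t.1.2; t.2].
by rewrite !h !big_ord1 h.
Qed.

Lemma tensmxN m n (A : 'M[K]_m) (B : 'M[K]_n) : A *t (- B) = - (A *t B).
Proof.
by apply/matrixP => i j; rewrite !mxE mulrN.
Qed.

Lemma J33_form n (L : set 'M[K]_n) : is_embedding (spinJ K 3 3) L ->
  exists q, n = (q * 4)%N /\ congruent L (C1 K q).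
Proof.
move=> /is_embeddingP[f [ef ->]].
have [p [W [C [sp _ [c [cs cf]]]]]] := spin3 ef.
have [q cq] := skew_involution sqrtK sp.
have cff := cong_trans cf (hblock_cong (fun t : K4 => t.1.1.1) (fun t => t.1.1.2)
  (fun t => t.1.2) (fun t => t.2) cq).
exists q; split; first by rewrite (cong_size cff); lia.
apply: (congruent_family4 cs); apply: (cong_trans cff); apply: cong_eq => t.
by rewrite /hblock tensmxN scalerN.
Qed.

Lemma embedding_J33 n (L : set 'M[K]_n) : is_embedding (spinJ K 3 3) L ->
  (4 %| n)%N /\ congruent L (C1 K (n %/ 4)).
Proof.
move=> /J33_form[q [en cL]]; have -> : (n %/ 4)%N = q by rewrite en mulnK.
  by split=> //; rewrite en dvdn_mull.
Qed.

Lemma embedding_J32 n (L : set 'M[K]_n) : is_embedding (spinJ K 3 2) L ->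
  ~~ odd n /\ exists k : nat,
   [/\ (1 <= k)%N, (8 * k <= n)%N & congruent L (C2 K (n %/ 2) k)].
Proof.
move=> /is_embeddingP[f [ef ->]].
have [p [W [C [sp C0 [c [cs cf]]]]]] := spin3 ef.
rewrite /= oppr0 in sp.
have [k [kp /(_ C0) k0 cq]] := skew_nilpotent sqrtK sp.
have en : n = (p + p)%N by exact: cong_size cf.
have -> : (n %/ 2)%N = p by rewrite en; lia.
split; first by rewrite en addnn odd_double.
exists k; split=> //; first by rewrite en; lia.
apply: (congruent_family4 cs); apply: (cong_trans cf).
have ep : p = (k * 2 + (p - k * 2))%N by lia.
move: (p - k * 2)%N ep cq => m em; move: W C {sp C0 cf en} kp; rewrite {p}em.
move=> W C _ cq.
apply: (cong_trans (hblock_cong _ _ _ _ cq)); apply: cong_eq => t.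
rewrite /hblock skew_diagmx_diag tensmxN; congr block_mx.
by rewrite -scalerN /diag2 opp_block_mx !oppr0.
Qed.

End SpinCases.

(** * The classification *)

Theorem theorem3p5 (R : realType) (n : nat) (n_ge1 : (1 <= n)%N) :
  let C : numFieldType := R[i] in
  let CJ : jordanAlg C := comJ C^o in
  let J (d r : nat) : jordanAlg C := spinJ C d r in
  (* (1) *)
  (forall L : set 'M[C]_n, is_embedding (prodJ (prodJ (prodJ CJ CJ) CJ) CJ) L ->
     exists k1 k2 k3 k4 : nat,
       [/\ (1 <= k4)%N, (k1 + 2 * k2 + 3 * k3 + 4 * k4 = n)%N
         & congruent L (A1 C k1 k2 k3 k4)]) /\
  (* (2) *)
  (forall L : set 'M[C]_n, is_embedding (prodJ (prodJ CJ CJ) (J 1%N 0%N)) L ->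
     exists k1 k2 l1 l2 : nat,
       [/\ (1 <= k2)%N, (1 <= l2)%N, (k1 + 2 * k2 + l1 + 2 * l2 = n)%N
         & congruent L (A2 C k1 k2 l1 l2)]) /\
  (* (3) *)
  ((forall L : set 'M[C]_n, is_embedding (prodJ (J 1%N 0%N) (J 1%N 0%N)) L ->
     exists k1 k2 l1 l2 : nat,
       [/\ (1 <= k2)%N, (1 <= l2)%N, (k1 + 2 * k2 + l1 + 2 * l2 = n)%N
         & congruent L (A3 C k1 k2 l1 l2)]) /\
   (forall k1 k2 l1 l2 : nat,
     (1 <= k2)%N -> (1 <= l2)%N -> (k1 + 2 * k2 + l1 + 2 * l2 = n)%N ->
     congruent (A3 C k1 k2 l1 l2) (A3 C l1 l2 k1 k2))) /\
  (* (4) *)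
  (forall L : set 'M[C]_n,
     is_embedding (prodJ CJ (comJ {poly %/ ('X^3 : {poly C})})) L ->
     exists r k1 k2 k3 : nat,
       [/\ (1 <= r)%N, (1 <= k3)%N, (r + (k1 + 2 * k2 + 3 * k3) = n)%N
         & congruent L (A4 C r k1 k2 k3)]) /\
  (* (5) *)
  (forall L : set 'M[C]_n, is_embedding (comJ {poly %/ ('X^4 : {poly C})}) L ->
     exists k1 k2 k3 k4 : nat,
       [/\ (1 <= k4)%N, (k1 + 2 * k2 + 3 * k3 + 4 * k4 = n)%N
         & congruent L (A5 C k1 k2 k3 k4)]) /\
  (* (6) *)
  (forall L : set 'M[C]_n, is_embedding (prodJ CJ (J 2%N 2%N)) L ->
     exists k1 k2 : nat,
       [/\ (1 <= k1)%N, (1 <= k2)%N, (k1 + 2 * k2 = n)%N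
         & congruent L (B1 C k1 k2)]) /\
  (* (7) *)
  (forall L : set 'M[C]_n, is_embedding (prodJ CJ (J 2%N 1%N)) L ->
     exists r k l1 l2 : nat,
       [/\ (1 <= r)%N, (2 <= l2)%N, (1 <= k)%N /\ (2 * k <= l2)%N,
           (r + (l1 + 2 * l2) = n)%N
         & congruent L (B2 C r k l1 l2)]) /\
  (* (8) *)
  ((~~ (4 %| n)%N -> forall L : set 'M[C]_n, ~ is_embedding (J 3%N 3%N) L) /\
   ((4 %| n)%N -> forall L : set 'M[C]_n, is_embedding (J 3%N 3%N) L ->
     congruent L (C1 C (n %/ 4)))) /\
  (* (9) *)
  ((odd n -> forall L : set 'M[C]_n, ~ is_embedding (J 3%N 2%N) L) /\
   (~~ odd n -> forall L : set 'M[C]_n, is_embedding (J 3%N 2%N) L ->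
     exists k : nat,
       [/\ (1 <= k)%N, (8 * k <= n)%N & congruent L (C2 C (n %/ 2) k)])).
Proof.
move=> C CJ J.
have sq (x : C) : exists y, y ^+ 2 = x by exists (sqrtc x); exact: sqr_sqrtc.
split; first by move=> L; exact: embedding_K_K_K_K.
split; first by move=> L; exact: embedding_K_K_J10.
split.
  split; first by move=> L; exact: embedding_J10_J10.
  by move=> k1 k2 l1 l2 _ _ _; exact: A3_swap.
split; first by move=> L; exact: embedding_K_trunc3.
split; first by move=> L; exact: embedding_trunc4.
split; first by move=> L; exact: embedding_K_J22.
split; first by move=> L; exact: embedding_K_J21.
split; split.
- by move=> n4 L /(embedding_J33 sq)[]; rewrite (negPf n4).
- by move=> _ L /(embedding_J33 sq)[].
- by move=> on L /(embedding_J32 sq)[]; rewrite on.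
- by move=> _ L /(embedding_J32 sq)[].
Qed.
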